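(* Let $\Gamma$ be a metric graph, let $D$ be a divisor on $\Gamma$, and let $G=(V,E)$ be a combinatorial graph underlying $\Gamma$ (that is, a model of $\Gamma$) such that $D$ is supported on $V$. For each integer $r\geq 0$, there are finitely many combinatorial subdivisions $H_1,\dots,H_k$ of $G$ and finitely many slope structures $\mathfrak S_1,\dots,\mathfrak S_k$ of width $r$, with $\mathfrak S_j$ defined on the graph $H_j$, such that for every admissible semimodule $M\subset\mathrm{Rat}(D)$ of rank $r$ with underlying slope structure $\mathfrak S$, there is an index $j\in\{1,\dots,k\}$ such that $H_j$ is a combinatorial model of $\Gamma$ on which $\mathfrak S$ is defined and $\mathfrak S=\mathfrak S_j$; that is, for a suitable choice of the positions in $\Gamma$ of the subdivision vertices of $H_j$, $\mathfrak S$ is the slope structure on $\Gamma$ induced by $\mathfrak S_j$.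
   Context: Metric graphs. A metric graph $\Gamma$ is the metric realization of a pair $(G,\ell)$, where $G=(V,E)$ is a finite connected graph with at least one edge and $\ell\colon E\to\mathbb R_{>0}$: each edge $e$ is replaced by a closed interval of length $\ell(e)$, glued according to $G$, with the path metric. $G$ (with $\ell$) is called a model of $\Gamma$; a model is simple if it has no loops and no parallel edges. $\mathrm T_x(\Gamma)$ is the finite set of outgoing unit tangent vectors at $x$, and $d_x=|\mathrm T_x(\Gamma)|$. $\mathrm{Rat}(\Gamma)$ is the set of continuous piecewise affine functions $f\colon\Gamma\to\mathbb R$ with integral slopes; $\mathrm{slope}_\nu(f)$ is the outgoing slope of $f$ along $\nu$. A divisor $D$ is a finite formal integer combination of points of $\Gamma$, $D(x)$ is its coefficient at $x$, $D\ge 0$ (effective) means all coefficients are $\geq 0$. $\mathrm{div}(f)=\sum_x \mathrm{ord}_x(f)(x)$ with $\mathrm{ord}_x(f)=-\sum_{\nu\in \mathrm T_x(\Gamma)}\mathrm{slope}_\nu(f)$. $\mathrm{Rat}(D)=\{f\in\mathrm{Rat}(\Gamma): D+\mathrm{div}(f)\ge 0\}$. A combinatorial subdivision of $G$ is an abstract graph obtained by replacing each edge of $G$ by a path; placing its new vertices in the interiors of the corresponding edges of $\Gamma$, in the prescribed order and at any distinct positions, makes it a model of $\Gamma$. Hypercube rank functions. Put $[r]=\{0,\dots,r\}$. The hypercube $[r]^\delta$ ($\delta\geq 1$) carries the coordinatewise order $\preceq$ and coordinatewise max $\vee$ and min $\wedge$; $\underline e_i$ is the $i$-th unit vector. A rank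 function is a map $\rho\colon[r]^\delta\to\mathbb Z$ such that: (1) $\rho(t\,\underline e_i)=r-t$ for all $i$ and $t\in[r]$; (2) $\underline a\preceq\underline b$ implies $\rho(\underline b)\le\rho(\underline a)$; (3) $\rho(\underline a)+\rho(\underline b)\le\rho(\underline a\vee\underline b)+\rho(\underline a\wedge\underline b)$; (4) $\rho$ takes values in $\{-1,0,\dots,r\}$. A jump of $\rho$ is a point $\underline a$ with $\rho(\underline a)\ge 0$ and $\rho(\underline a+\underline e_i)=\rho(\underline a)-1$ for every $i$ with $\underline a+\underline e_i\in[r]^\delta$. The standard rank function is $\rho(\underline a)=\max\{-1,r-a_1-\dots-a_\delta\}$. Slope structures. A slope structure of width $r$ on a simple graph $H=(V',E')$ is the data of: for every oriented edge $uv$, a set $S^{uv}$ of integers $s_0^{uv}<\dots<s_r^{uv}$ with $s_i^{uv}+s_{r-i}^{vu}=0$; for every $v\in V'$, a rank function $\rho_v$ on $[r]^{d_v}$ ($d_v$ the valence of $v$), whose coordinates are indexed by the oriented edges with tail $v$. A slope structure $\mathfrak S$ of width $r$ on $\Gamma$ is one induced from some simple graph model $H$ of $\Gamma$ (one then says that $\mathfrak S$ is defined on $H$) as follows: for $x\in\Gamma$, $\nu\in \mathrm T_x(\Gamma)$, $S^\nu=\{s_0^\nu<\dots<s_r^\nu\}$ is $S^{uv}$ for the oriented edge $uv$ of $H$ parallel to $\nu$; for $x\in\Gamma\setminus V'$, $\rho_x$ is the standard rank function on $[r]^2$. Two slope structures on $\Gamma$ are equal if all sets $S^\nu$ and rank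 functions $\rho_x$ agree. For $\underline a=(a_\nu)_\nu\in[r]^{\mathrm T_x(\Gamma)}$ put $s_{\underline a}=(s^\nu_{a_\nu})_\nu$, and let $S^x=\{s_{\underline a}:\underline a\text{ a jump of }\rho_x\}$. A function $f\in\mathrm{Rat}(\Gamma)$ is compatible with $\mathfrak S$ if for every $x\in\Gamma$, $\mathrm{slope}_\nu(f)\in S^\nu$ for all $\nu\in\mathrm T_x(\Gamma)$, and $\partial_x(f):=(\mathrm{slope}_\nu(f))_{\nu\in \mathrm T_x(\Gamma)}\in S^x$. If $\partial_x(f)=s_{\underline a}$, write $\rho_x(\partial_x(f)):=\rho_x(\underline a)$. $\mathrm{Rat}(D,\mathfrak S)$ is the set of $f\in\mathrm{Rat}(D)$ compatible with $\mathfrak S$. Admissible semimodules. A semimodule is a subset of $\mathrm{Rat}(\Gamma)$ stable under $(f,g)\mapsto\min(f,g)$ and $f\mapsto f+c$, $c\in\mathbb R$. A semimodule $M\subseteq\mathrm{Rat}(D)$ is admissible of rank $r$, with underlying slope structure $\mathfrak S$, if it is closed for the topology of $\|\cdot\|_\infty$, $\mathfrak S$ is a slope structure of width $r$ on $\Gamma$ with $M\subseteq\mathrm{Rat}(D,\mathfrak S)$, and for every effective divisor $E$ of degree $r$ there is $f\in M$ with $\rho_x(\partial_x(f))\ge E(x)$ for all $x\in\Gamma$ and $D+\mathrm{div}(f)-E\ge 0$. *)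

(* Defs.v *)
From mathcomp Require Import all_boot all_order all_algebra.
From mathcomp Require Import all_classical all_reals all_analysis.
Set Implicit Arguments.
Unset Strict Implicit.
Unset Printing Implicit Defensive.
Import Order.TTheory GRing.Theory Num.Theory numFieldNormedType.Exports.
Local Open Scope classical_set_scope.
Local Open Scope ring_scope.

(* Undirected multigraphs: src and tgt only fix a reference orientation. *)
Record graph := Graph {
  vertex : finType;
  edge : finType;
  src : edge -> vertex;
  tgt : edge -> vertex }.

(* Oriented edges: (e, false) runs from src e to tgt e, (e, true) backwards. *)
Definition dart (G : graph) : finType := (edge G * bool)%type.

Definition dart_tail (G : graph) (d : dart G) : vertex G :=
  if d.2 then tgt d.1 else src d.1.

Definition dart_head (G : graph) (d : dart G) : vertex G :=
  if d.2 then src d.1 else tgt d.1.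

Definition rev_dart (G : graph) (d : dart G) : dart G := (d.1, ~~ d.2).

Definition adj_vertices (G : graph) : rel (vertex G) :=
  fun u v => [exists d : dart G, (dart_tail d == u) && (dart_head d == v)].

Definition connected_graph (G : graph) : Prop :=
  forall u v : vertex G, connect (@adj_vertices G) u v.

Definition simple_graph (G : graph) : Prop :=
  (forall d : dart G, dart_tail d != dart_head d) /\
  (forall d d' : dart G,
     dart_tail d = dart_tail d' -> dart_head d = dart_head d' -> d = d').

Section MetricGraph.
Context {R : realType} {G : graph}.
Implicit Type len : edge G -> R.

Definition metric_graph len : Prop :=
  [/\ connected_graph G, (0 < #|edge G|)%N & forall e, 0 < len e].

(* A point of the realization is either a vertex or a pair (e, t) with
   0 < t < len e: the point at distance t from src e in the open edge e. *)
Definition gpoint len : Type :=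
  (vertex G + {p : edge G * R | 0 < p.2 < len p.1})%type.

(* The point at parameter t of the closed interval [0, len e] glued along e;
   parameters outside of this interval are sent to the nearest end. *)
Definition edge_point len (e : edge G) (t : R) : gpoint len :=
  if insub (e, t) is Some p then inr p
  else inl (if t <= 0 then src e else tgt e).

(* The path metric: a step (e, s, t) follows the edge e from parameter s to
   parameter t, and has length |t - s|. *)
Fixpoint walk len (x : gpoint len) (w : seq (edge G * R * R)) (y : gpoint len)
    : Prop :=
  if w is (e, s, t) :: w' then
    [/\ 0 <= s <= len e, 0 <= t <= len e, x = edge_point len e s
      & walk (edge_point len e t) w' y]
  else x = y.

Definition walk_length (w : seq (edge G * R * R)) : R :=
  \sum_(st <- w) `|st.2 - st.1.2|.

Definition gdist len (x y : gpoint len) : R :=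
  inf [set walk_length w | w in [set w | walk x w y]].

Definition starts_at len (x : gpoint len) (d : dart G) : bool :=
  match x with
  | inl v => dart_tail d == v
  | inr p => d.1 == (val p).1
  end.

(* A loop at x contributes its two orientations. *)
Definition tangent len (x : gpoint len) : finType :=
  {d : dart G | starts_at x d}.

(* For small t >= 0, the point at distance t from x in the direction nu. *)
Definition move_along len (x : gpoint len) (nu : tangent x) (t : R)
    : gpoint len :=
  let d := val nu in
  let c := match x with
           | inl _ => if d.2 then len d.1 else 0
           | inr p => (val p).2
           end in
  edge_point len d.1 (if d.2 then c - t else c + t).

(* 0 = c 0 < c 1 < ... < c m = L; the values of c beyond m are irrelevant. *)
Definition cuts (m : nat) (L : R) (c : nat -> R) : Prop :=
  [/\ c 0%N = 0, c m = L & forall k, (k < m)%N -> c k < c k.+1].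

(* The affine pieces are closed intervals, which makes f continuous on every
   closed edge, hence on the whole graph. *)
Definition RatG len : set (gpoint len -> R) :=
  [set f | forall e : edge G, exists m c, cuts m (len e) c /\
     forall k, (k < m)%N -> exists s : int, forall t, c k <= t <= c k.+1 ->
       f (edge_point len e t)
       = f (edge_point len e (c k)) + s%:~R * (t - c k)].

(* Junk value 0 if f has no integral slope along nu; unique otherwise. *)
Definition slope len (f : gpoint len -> R) (x : gpoint len) (nu : tangent x)
    : int :=
  xget 0 [set s : int |
    \forall t \near 0^'+, f (move_along nu t) = f x + s%:~R * t].

Record divisor len := Divisor {
  coef :> gpoint len -> int;
  coef_finite : finite_set [set x | coef x != 0] }.

Definition degree len (D : divisor len) : int :=
  \sum_(x \in [set: gpoint len]) D x.

Definition effective len (D : divisor len) : Prop := forall x, 0 <= D x.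

Definition supported_on_vertices len (D : divisor len) : Prop :=
  forall x : gpoint len, D x != 0 -> exists v : vertex G, x = inl v.

(* The coefficient of div(f) at x. *)
Definition ord len (f : gpoint len -> R) (x : gpoint len) : int :=
  - \sum_(nu : tangent x) slope f nu.

Definition RatD len (D : divisor len) : set (gpoint len -> R) :=
  [set f | RatG f /\ forall x, 0 <= D x + ord f x].

End MetricGraph.

Section Hypercube.
Context {r : nat} {I : finType}.

Definition cube : Type := {ffun I -> 'I_r.+1}.

Definition axis (i : I) (t : 'I_r.+1) : cube :=
  [ffun j => if j == i then t else ord0].

Definition cube_le (a b : cube) : Prop := forall i, (a i <= b i)%N.

Definition cube_join (a b : cube) : cube := [ffun i => Order.max (a i) (b i)].
Definition cube_meet (a b : cube) : cube := [ffun i => Order.min (a i) (b i)].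

(* a + e_i; only meaningful if a i < r. *)
Definition cube_succ (a : cube) (i : I) : cube :=
  [ffun j => if j == i then inord (a j).+1 else a j].

Definition rank_function (rho : cube -> int) : Prop :=
  [/\ forall (i : I) (t : 'I_r.+1), rho (axis i t) = r%:Z - t%:Z,
      forall a b, cube_le a b -> rho b <= rho a,
      forall a b, rho a + rho b <= rho (cube_join a b) + rho (cube_meet a b)
    & forall a, -1 <= rho a <= r%:Z].

Definition jump (rho : cube -> int) (a : cube) : Prop :=
  0 <= rho a /\
  forall i, (a i < r)%N -> rho (cube_succ a i) = rho a - 1.

Definition standard_rank (a : cube) : int :=
  Num.max (-1) (r%:Z - \sum_i (a i)%:Z).

End Hypercube.
Arguments cube : clear implicits.

Record graph_slope_structure (r : nat) (H : graph) := GraphSlopeStructure {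
  gss_simple : simple_graph H;
  (* gslope d i is s_i on the oriented edge d *)
  gslope : dart H -> 'I_r.+1 -> int;
  gslope_incr : forall d (i j : 'I_r.+1), (i < j)%N -> gslope d i < gslope d j;
  gslope_rev : forall d i, gslope d i + gslope (rev_dart d) (rev_ord i) = 0;
  grank : forall v : vertex H, cube r {d : dart H | dart_tail d == v} -> int;
  grank_rank : forall v, rank_function (@grank v) }.

Record slope_data (r : nat) (R : realType) (G : graph) (len : edge G -> R) :=
  SlopeData {
  sl : forall x : gpoint len, tangent x -> 'I_r.+1 -> int;
  rk : forall x : gpoint len, cube r (tangent x) -> int }.

(* The slope data given by s on the realization of H itself. *)
Definition realize (r : nat) (H : graph) (s : graph_slope_structure r H)
    (R : realType) (len : edge H -> R) : slope_data r len :=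
  {| sl := fun x nu i => gslope s (val nu) i;
     rk := fun x => match x return cube r (tangent x) -> int with
                    | inl v => @grank r H s v
                    | inr _ => standard_rank
                    end |}.

Definition mg_isometry (R : realType) (H G : graph) (lenH : edge H -> R)
    (lenG : edge G -> R) (phi : gpoint lenH -> gpoint lenG) : Prop :=
  bijective phi /\ forall x y, gdist (phi x) (phi y) = gdist x y.

(* S' is the image of S under phi; the bijection dphi between tangent vectors
   is the differential of phi at x. *)
Definition transports (r : nat) (R : realType) (H G : graph)
    (lenH : edge H -> R) (lenG : edge G -> R) (phi : gpoint lenH -> gpoint lenG)
    (S : slope_data r lenH) (S' : slope_data r lenG) : Prop :=
  forall x : gpoint lenH, exists dphi : tangent x -> tangent (phi x),
    [/\ bijective dphi,
        forall nu, \forall t \near 0^'+,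
          phi (move_along nu t) = move_along (dphi nu) t,
        forall nu i, sl S' (dphi nu) i = sl S nu i
      & forall a : cube r (tangent (phi x)),
          rk S' a = rk S [ffun nu => a (dphi nu)]].

(* H, with edge lengths lenH, is a model of the metric graph (via phi), and S
   is the slope structure induced from s on it. *)
Definition induced_from (r : nat) (R : realType) (H G : graph)
    (lenH : edge H -> R) (lenG : edge G -> R) (phi : gpoint lenH -> gpoint lenG)
    (s : graph_slope_structure r H) (S : slope_data r lenG) : Prop :=
  [/\ metric_graph lenH, mg_isometry phi & transports phi (realize s lenH) S].

Definition slope_structure (r : nat) (R : realType) (G : graph)
    (len : edge G -> R) (S : slope_data r len) : Prop :=
  exists (H : graph) (lenH : edge H -> R) (phi : gpoint lenH -> gpoint len)
         (s : graph_slope_structure r H), induced_from phi s S.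

Section Semimodule.
Context {r : nat} {R : realType} {G : graph} {len : edge G -> R}.

(* The vector of outgoing slopes of f at x is s_a, with a a jump; such an a is
   unique when S is a slope structure. *)
Definition slopes_at (S : slope_data r len) (f : gpoint len -> R)
    (x : gpoint len) (a : cube r (tangent x)) : Prop :=
  jump (rk S (x := x)) a /\ forall nu, slope f nu = sl S nu (a nu).

Definition compatible (S : slope_data r len) (f : gpoint len -> R) : Prop :=
  forall x : gpoint len,
    (forall nu : tangent x, exists i, slope f nu = sl S nu i) /\
    exists a : cube r (tangent x), slopes_at S f a.

Definition RatDS (D : divisor len) (S : slope_data r len)
    : set (gpoint len -> R) :=
  [set f | RatD D f /\ compatible S f].

Definition semimodule (M : set (gpoint len -> R)) : Prop :=
  [/\ M `<=` @RatG R G len,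
      forall f g, M f -> M g -> M (f \min g)
    & forall f (c : R), M f -> M (fun x => f x + c)].

(* Closed in RatG for the topology of uniform convergence. *)
Definition sup_norm_closed (M : set (gpoint len -> R)) : Prop :=
  closure (M : set {uniform gpoint len -> R}) `&` @RatG R G len `<=` M.

Definition admissible (D : divisor len) (M : set (gpoint len -> R))
    (S : slope_data r len) : Prop :=
  [/\ semimodule M,
      sup_norm_closed M,
      slope_structure S,
      M `<=` RatDS D S
    & forall E : divisor len, effective E -> degree E = r%:Z ->
        exists f, [/\ M f,
          forall x, exists2 a : cube r (tangent x),
            slopes_at S f a & E x <= rk S a
        & forall x, 0 <= D x + ord f x - E x]].

End Semimodule.

Section Subdivision.
Context {G : graph}.
Implicit Type n : edge G -> nat.

(* Each edge e is replaced by a path with n e new inner vertices; its nodes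
   are numbered from 0 (src e) to n e + 1 (tgt e), the k-th new vertex
   (k < n e) being node k.+1. *)
Definition sub_vertex n : finType := (vertex G + {e : edge G & 'I_(n e)})%type.

Definition node n (e : edge G) (k : nat) : sub_vertex n :=
  if k is k'.+1 then
    if insub k' is Some i then inr (existT (fun e' => 'I_(n e')) e i)
    else inl (tgt e)
  else inl (src e).

Definition subdivision n : graph :=
  {| vertex := sub_vertex n;
     edge := {e : edge G & 'I_(n e).+1};
     src := fun p => node n (tag p) (tagged p);
     tgt := fun p => node n (tag p) (tagged p).+1 |}.

Context {R : realType}.
Implicit Type len : edge G -> R.

(* pos e k is the position (distance from src e) of the k-th node of e. *)
Definition positions n len (pos : edge G -> nat -> R) : Prop :=
  forall e, cuts (n e).+1 (len e) (pos e).

Definition sub_len n (pos : edge G -> nat -> R) (p : edge (subdivision n)) : R :=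
  pos (tag p) (tagged p).+1 - pos (tag p) (tagged p).

Definition subdivision_map n len (pos : edge G -> nat -> R)
    (x : gpoint (@sub_len n pos)) : gpoint len :=
  match x with
  | inl (inl v) => inl v
  | inl (inr p) => edge_point len (tag p) (pos (tag p) (tagged p).+1)
  | inr q => let p := (val q).1 in
             edge_point len (tag p) (pos (tag p) (tagged p) + (val q).2)
  end.

End Subdivision.

(* Main.v *)
Require Import Defs.
From mathcomp Require Import all_boot all_order all_algebra.
From mathcomp Require Import all_classical all_reals all_analysis.
From mathcomp Require Import ring lra zify.
Set Implicit Arguments.
Unset Strict Implicit.
Unset Printing Implicit Defensive.
Import Order.TTheory GRing.Theory Num.Theory numFieldNormedType.Exports.
Local Open Scope classical_set_scope.
Local Open Scope ring_scope.

(** Let [B] be the sum over the vertices [v] of [`|D v|]. The proof bounds by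
    [B] all the slopes that occur in the slope structure of an admissible
    semimodule [M] of rank [r], and bounds, in terms of [r] and [B] only, the
    number of points inside an edge at which this structure is not smooth.

    Slopes ([graph_slope_bound], [right_slope_le], [left_slope_le]). As [D] is
    supported on the vertices, a function [f] in Rat(D) is concave on each
    edge, and the outgoing slopes of [f] at a vertex [v] add up to at most
    [D v]. Summing over the vertices at which [f] is at most [f v], the edges
    inside of this set contribute nonnegatively by concavity, and so do the
    edges leaving it: a slope leading up from [v] is at most [B]. It follows
    that every slope of [f] has absolute value at most [B].

    The members of [M] that answer effective divisors transfer this to the
    slope structure. If [x] is a point inside an edge with standard rank
    function, the function answering the divisor [r x] has the extreme slopes
    [s_0] and [s_r] at [x], so that all [s_i] are bounded by [B]
    ([run_bound]). If [t] is any point inside an edge, with slopes [s] just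
    before [t] and [s'] just after it, the function answering
    [(r - i) y + i z], for [y] just before [t] and [z] just after it, has, by
    concavity, at [t] a left slope at most [s_i] and a right slope at least
    [s'_i], where the right slope is at most the left one ([squeeze]). Hence
    [s'_i <= s_i]: slopes can only decrease along an edge. If moreover
    [s' = s], these functions show that all the points of the antidiagonal
    [(r - i, i)] are jumps of the rank function at [t], which forces this rank
    function to be standard ([standard_of_jumps]); then [t] is a smooth point
    ([run_merge]). The sum of the slopes [s_i] thus drops at each point that is
    not smooth, so that there are boundedly many such points on an edge
    ([admissible_cuts]).

    Therefore one subdivision, with the same large number of new vertices on
    every edge, serves for all [M]: put the new vertices at the points that are
    not smooth, and the superfluous ones anywhere. On this graph there are
    finitely many slope structures with slopes bounded by [B]
    ([finitely_many_gss]), and [sub_structure_induced] shows that the slope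
    structure of [M] is induced from one of them. *)

(** * Subdivisions of an interval, and darts of a metric graph *)

Lemma near0_rightP (R : realType) (P : R -> Prop) :
  (\forall t \near 0^'+, P t) <->
  exists2 eps : R, 0 < eps & forall t, 0 < t < eps -> P t.
Proof.
split=> [|[eps eps0 hP]].
  rewrite near_withinE => /nbhs_ballP[eps /= eps0 hP].
  exists eps => // t /andP[t0 te]; apply: hP => //=.
  by rewrite /ball/= sub0r normrN gtr0_norm.
rewrite near_withinE; apply/nbhs_ballP; exists eps => //= t.
rewrite /ball/= sub0r normrN => te t0; apply: hP.
by rewrite t0 -(gtr0_norm t0).
Qed.

Section Cuts.
Context {R : realType}.
Implicit Types (m : nat) (L : R) (c : nat -> R).

Lemma cuts_le m L c i j : cuts m L c -> (i <= j <= m)%N -> c i <= c j.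
Proof.
move=> [_ _ h]; elim: j => [|j IH] /andP[ij jm].
  by move: ij; rewrite leqn0 => /eqP->.
move: ij; rewrite leq_eqVlt => /orP[/eqP->//|]; rewrite ltnS => ij.
apply: (@le_trans _ _ (c j)); last exact/ltW/h.
by apply: IH; rewrite ij ltnW.
Qed.

Lemma cuts_gt0 m L c : 0 < L -> cuts m L c -> (0 < m)%N.
Proof. by move=> L0 [c0 cm _]; case: m cm => // cm; move: L0; rewrite -cm c0 ltxx. Qed.

Lemma cuts_bound m L c k : cuts m L c -> (k <= m)%N -> 0 <= c k <= L.
Proof.
move=> hc km; have [c0 cm _] := hc.
by rewrite -c0 -cm !(cuts_le hc) ?leqnn ?km.
Qed.

Lemma cuts_lt m L c i j : cuts m L c -> (i < j <= m)%N -> c i < c j.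
Proof.
move=> hc /andP[ij jm]; have [_ _ h] := hc.
apply: (@lt_le_trans _ _ (c i.+1)); first exact/h/(leq_trans ij).
by apply: (cuts_le hc); rewrite ij.
Qed.

Lemma cuts_locate_right m L c t : cuts m L c -> 0 <= t < L ->
  exists2 k, (k < m)%N & c k <= t < c k.+1.
Proof.
move=> [c0 cm _] /andP[t0 tL].
have : exists k, (t < c k) by exists m; rewrite cm.
case/ex_minnP => -[|k] tk kmin; first by rewrite c0 ltNge t0 in tk.
exists k; first by apply: kmin; rewrite cm.
rewrite tk andbT leNgt; apply/negP => /kmin; by rewrite ltnn.
Qed.

Lemma cuts_locate_left m L c t : cuts m L c -> 0 < t <= L ->
  exists2 k, (k < m)%N & c k < t <= c k.+1.
Proof.
move=> [c0 cm _] /andP[t0 tL].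
have : exists k, (t <= c k) by exists m; rewrite cm.
case/ex_minnP => -[|k] tk kmin; first by rewrite c0 leNgt t0 in tk.
exists k; first by apply: kmin; rewrite cm.
rewrite tk andbT ltNge; apply/negP => /kmin; by rewrite ltnn.
Qed.

(** Compactness of the interval from [0] to [L]: if every point is an end of
    short intervals with the property [Q] on both of its sides, then finitely
    many intervals with this property cover it, end to end. *)
Lemma local_cuts (Q : R -> R -> Prop) L : 0 < L ->
  (forall t, 0 <= t < L -> exists2 eps, 0 < eps &
     forall u, t < u < t + eps -> Q t u) ->
  (forall t, 0 < t <= L -> exists2 eps, 0 < eps &
     forall u, t - eps < u < t -> Q u t) ->
  exists m c, cuts m L c /\ forall k, (k < m)%N -> Q (c k) (c k.+1).
Proof.
move=> L0 hr hl.
pose good u := exists m c, cuts m u c /\ forall k, (k < m)%N -> Q (c k) (c k.+1).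
have extend u v : good u -> u < v -> Q u v -> good v.
  move=> [m [c [[c0 cm cS] cQ]]] uv quv.
  exists m.+1, (fun k => if (k <= m)%N then c k else v); split; first split.
  - by [].
  - by rewrite ltnn.
  - move=> k; rewrite ltnS => km; rewrite km.
    by case: ltngtP km => // [km _|-> _]; [exact: cS|rewrite cm].
  - move=> k; rewrite ltnS => km; rewrite km.
    by case: ltngtP km => // [km _|-> _]; [exact: cQ|rewrite cm].
have good0 : good 0 by exists 0%N, (fun=> 0).
pose A := [set u | 0 <= u <= L /\ good u].
have A0 : A 0 by split=> //; rewrite lexx ltW.
have Aub : ubound A L by move=> u [/andP[]].
have hs : has_sup A by split; [exists 0|exists L].
pose s := sup A.
have s0 : 0 <= s by apply: sup_upper_bound.
have sL : s <= L by apply: ge_sup => //; exists 0.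
have gs : good s.
  have [->//|sn0] := eqVneq s 0.
  have sp : 0 < s by rewrite lt_neqAle eq_sym sn0.
  have [|eps e0 he] := hl s; first by rewrite sp.
  have [u Au su] := sup_adherent e0 hs.
  have us : u <= s by apply: sup_upper_bound.
  move: us; rewrite le_eqVlt => /orP[/eqP <-|us]; first by case: Au.
  apply: (extend u) => //; first by case: Au.
  by apply: he; rewrite su us.
have [<-//|sneL] := eqVneq s L.
have sltL : s < L by rewrite lt_neqAle sneL.
have [|eps e0 he] := hr s; first by rewrite s0.
pose d := Num.min (eps / 2) (L - s).
have d0 : 0 < d by rewrite /d lt_min divr_gt0//= subr_gt0.
have de : d < eps.
  apply: (@le_lt_trans _ _ (eps / 2)); first by rewrite /d ge_min lexx.
  by rewrite ltr_pdivrMr// mulr_natr mulr2n ltrDr.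
have dL : s + d <= L by rewrite -lerBrDl /d ge_min lexx orbT.
have : s + d <= s.
  apply: sup_upper_bound => //; split.
    by rewrite dL andbT addr_ge0// ltW.
  apply: (extend s) => //; first by rewrite ltrDl.
  by apply: he; rewrite ltrDl d0 ltrD2l.
by rewrite gerDl leNgt d0.
Qed.

End Cuts.

Section Darts.
Context {R : realType} {G : graph}.
Variable len : edge G -> R.

Lemma rev_dartK : involutive (@rev_dart G).
Proof. by move=> [e b]; rewrite /rev_dart/= negbK. Qed.

Lemma dart_tail_rev (d : dart G) : dart_tail (rev_dart d) = dart_head d.
Proof. by case: d => e []. Qed.

Lemma dart_head_rev (d : dart G) : dart_head (rev_dart d) = dart_tail d.
Proof. by case: d => e []. Qed.

(** The point at distance [u] from the tail of [d] on the edge carrying [d]. *)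
Definition dart_point (d : dart G) (u : R) : gpoint len :=
  edge_point len d.1 (if d.2 then len d.1 - u else u).

(** The distance from the tail of [d] to [x] along [d], when [starts_at x d];
    the first case covers a loop, for which [x] is then also the head of [d]. *)
Definition dart_pos (x : gpoint len) (d : dart G) : R :=
  match x with
  | inl _ => 0
  | inr p => if d.2 then len d.1 - (val p).2 else (val p).2
  end.

Lemma edge_point_inner e t (ht : 0 < (e, t).2 < len (e, t).1) :
  edge_point len e t = inr (exist _ (e, t) ht).
Proof. by rewrite /edge_point insubT. Qed.

Lemma edge_point_src e t : t <= 0 -> edge_point len e t = inl (src e).
Proof.
move=> t0; rewrite /edge_point insubF ?t0//=.
by rewrite ltNge t0.
Qed.

Hypothesis len0 : forall e, 0 < len e.

Lemma edge_point_tgt e t : len e <= t -> edge_point len e t = inl (tgt e).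
Proof.
move=> t0; rewrite /edge_point insubF/=; last by rewrite [_ < len e]ltNge t0 andbF.
by rewrite leNgt (lt_le_trans (len0 e) t0).
Qed.

Lemma edge_point_inj e t e' t' : 0 < t < len e ->
  edge_point len e t = edge_point len e' t' -> e' = e /\ t' = t.
Proof.
move=> ht; rewrite (@edge_point_inner e t ht) /edge_point.
case: insubP => [p _ hp|//] hpt.
have {}hpt : exist _ (e, t) ht = p by case: hpt.
by move: hp; rewrite -hpt /= => -[-> ->].
Qed.

Lemma dart_point_inj d u d' u' : 0 < u < len d.1 ->
  dart_point d u = dart_point d' u' ->
  d'.1 = d.1 /\ u' = if d'.2 == d.2 then u else len d.1 - u.
Proof.
case: d d' => [e b] [e' b'] /= /andP[u0 uL]; rewrite /dart_point/=.
case/edge_point_inj; first by case: b; lra.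
by case: b b' => [] [] /= -> h; split=> //; lra.
Qed.

Lemma dart_point_tail d : dart_point d 0 = inl (dart_tail d).
Proof.
case: d => e []; rewrite /dart_point/=; last exact: edge_point_src.
by rewrite subr0 edge_point_tgt.
Qed.

Lemma rev_dart_point d u : dart_point (rev_dart d) u = dart_point d (len d.1 - u).
Proof. by case: d => e [] //=; rewrite /dart_point/= opprB addrC subrK. Qed.

Lemma starts_at_dart_point d u : 0 <= u < len d.1 -> starts_at (dart_point d u) d.
Proof.
case/andP; rewrite le_eqVlt => /orP[/eqP <- _|u0 uL]; first by rewrite dart_point_tail/=.
rewrite /dart_point edge_point_inner/=; first by case: d.2; lra.
by move=> *; exact: eqxx.
Qed.

Lemma dart_posE d u : 0 <= u < len d.1 -> dart_pos (dart_point d u) d = u.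
Proof.
case/andP; rewrite le_eqVlt => /orP[/eqP <- _|u0 uL]; first by rewrite dart_point_tail/=.
rewrite /dart_point edge_point_inner/=; first by case: d.2; lra.
by move=> *; case: d.2; lra.
Qed.

Lemma dart_pos_bound x d : starts_at x d -> 0 <= dart_pos x d < len d.1.
Proof.
case: x => [v _|[[e t]/= /andP[t0 tL]] /= /eqP->]; first by rewrite lexx len0.
by case: d.2; lra.
Qed.

Lemma dart_point_pos x d : starts_at x d -> dart_point d (dart_pos x d) = x.
Proof.
case: x => [v /eqP <-|[[e t] /= ht] /= /eqP hd]; first exact: dart_point_tail.
rewrite /dart_point hd -(edge_point_inner ht) /=; congr edge_point.
by case: d.2; lra.
Qed.

Lemma move_alongE x (nu : tangent x) t :
  move_along nu t = dart_point (val nu) (dart_pos x (val nu) + t).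
Proof.
rewrite /move_along /dart_point; congr edge_point.
by case: x nu => [v|p] nu /=; case: (val nu).2; lra.
Qed.

End Darts.

(** * Slopes of the functions in Rat(D) along an edge *)

Lemma sum_nat_gt0 (R : numDomainType) m (F : nat -> R) :
  (0 < m)%N -> (forall k, (k < m)%N -> 0 < F k) -> 0 < \sum_(0 <= k < m) F k.
Proof.
case: m => // m _ hF; rewrite big_nat_recr//= ltr_wpDl ?hF//.
rewrite big_nat_cond sumr_ge0// => k /andP[/andP[_ km] _].
by rewrite ltW ?hF// ltnW.
Qed.

Section Slopes.
Context {R : realType} {G : graph}.
Variable len : edge G -> R.
Hypothesis len0 : forall e, 0 < len e.
Implicit Types (f : gpoint len -> R) (x : gpoint len) (d : dart G).

(** The slope of [f] at [x] along the dart [d], as a total function of [d]. *)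
Definition dslope f x d : int :=
  if insub d is Some nu then slope f (nu : tangent x) else 0.

Lemma dslopeE f x (nu : tangent x) : dslope f x (val nu) = slope f nu.
Proof. by rewrite /dslope valK. Qed.

Lemma dslope_eq f d u (s : int) eps : 0 <= u < len d.1 -> 0 < eps ->
  (forall t, 0 < t < eps ->
     f (dart_point len d (u + t)) = f (dart_point len d u) + s%:~R * t) ->
  dslope f (dart_point len d u) d = s.
Proof.
move=> hu eps0 hs.
have hd := starts_at_dart_point len0 hu.
rewrite /dslope insubT /slope.
set A := (X in xget 0 X).
have move_u t : move_along (Sub d hd : tangent (dart_point len d u)) t
    = dart_point len d (u + t).
  by rewrite move_alongE/= dart_posE.
have As : A s.
  by apply/near0_rightP; exists eps => // t ht; rewrite move_u hs.
case: xgetP => [s' _ As'|/(_ s)//].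
have [e1 e10 h1] := (near0_rightP _).1 As'.
set t := Num.min (eps / 2) (e1 / 2).
have ht : [/\ 0 < t, t < eps & t < e1].
  by rewrite /t; case: (leP (eps / 2) (e1 / 2)) => h; split; lra.
have [t0 te te1] := ht.
have := h1 t; rewrite t0 te1 move_u hs ?t0// => /(_ isT) /addrI.
by move/mulIf => /(_ (lt0r_neq0 t0)) /eqP; rewrite eqr_int => /eqP.
Qed.

(** The slope of [f] on the right of the parameter [t] of the edge [e]. *)
Definition right_slope f e t := dslope f (edge_point len e t) (e, false).

(** The slope of [f] on the left of [t], in the direction of increasing
    parameters: the opposite of the outgoing slope. *)
Definition left_slope f e t := - dslope f (edge_point len e t) (e, true).

(** [f] is affine with slope [sg k] on the [k]-th interval of the subdivision
    [c] of the edge [e]. *)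
Definition pieces f e m (c : nat -> R) (sg : nat -> int) : Prop :=
  cuts m (len e) c /\ forall k, (k < m)%N ->
  [/\ forall t, c k <= t < c k.+1 -> right_slope f e t = sg k,
      forall t, c k < t <= c k.+1 -> left_slope f e t = sg k &
      f (edge_point len e (c k.+1)) - f (edge_point len e (c k))
      = (sg k)%:~R * (c k.+1 - c k)].

Lemma RatG_pieces f e : RatG f -> exists m c sg, pieces f e m c sg.
Proof.
move=> /(_ e) [m [c [hc hp]]].
have : forall k, exists s : int, (k < m)%N -> forall t, c k <= t <= c k.+1 ->
  f (edge_point len e t) = f (edge_point len e (c k)) + s%:~R * (t - c k).
  move=> k; case: (boolP (k < m)%N) => [km|nkm]; last by exists 0.
  by have [s hs] := hp k km; exists s.
case/choice => sg hsg; exists m, c, sg; split=> // k km.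
have [c0 cm cS] := hc; have {}hsg := hsg k km.
have cb : 0 <= c k /\ c k.+1 <= len e.
  by have /andP[-> _] := cuts_bound hc (ltnW km); have /andP[_ ->] := cuts_bound hc km.
split.
- move=> t /andP[ct tc].
  apply: (@dslope_eq f (e, false) t (sg k) (c k.+1 - t)) => /=; [lra|lra|].
  move=> u hu; rewrite /dart_point/= (hsg (t + u)) ?(hsg t); [ring|lra|lra].
- move=> t /andP[ct tc]; apply/eqP; rewrite eqr_oppLR; apply/eqP.
  rewrite -[t in edge_point _ _ t](subKr (len e)).
  apply: (@dslope_eq f (e, true) (len e - t) (- sg k) (t - c k)) => /=; [lra|lra|].
  move=> u hu; rewrite /dart_point/= opprD addrA !subKr.
  rewrite (hsg (t - u)) ?(hsg t); [rewrite rmorphN/=; ring|lra|lra].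
- rewrite hsg; last by rewrite lexx andbT; exact/ltW/cS.
  by rewrite addrC addKr.
Qed.

Lemma big_tangent f x :
  \sum_(nu : tangent x) slope f nu = \sum_(d | starts_at x d) dslope f x d.
Proof.
rewrite [RHS](reindex_omap (val : tangent x -> dart G) insub); last first.
  by move=> d hd; rewrite insubT.
under [RHS]eq_bigr do rewrite dslopeE.
by apply: eq_bigl => nu; rewrite valK (valP nu) eqxx.
Qed.

Lemma pieces_gt0 f e m c sg : pieces f e m c sg -> (0 < m)%N.
Proof. by move=> [hc _]; exact: (cuts_gt0 (len0 e) hc). Qed.

Section RatD.
Variable (D : divisor len).
Hypothesis hD : supported_on_vertices D.
Variable (f : gpoint len -> R).
Hypothesis hf : RatD D f.

Lemma right_slope_le_left e t : 0 < t < len e ->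
  right_slope f e t <= left_slope f e t.
Proof.
move=> ht; have := hf.2 (edge_point len e t).
have -> : D (edge_point len e t) = 0.
  apply/eqP; apply: contraTT isT => /hD[v].
  by rewrite (@edge_point_inner _ _ _ e t ht).
rewrite add0r /ord big_tangent (bigD1 (e, false))/=; last first.
  by rewrite (@edge_point_inner _ _ _ e t ht) /= eqxx.
rewrite (bigD1 (e, true))/=; last first.
  by rewrite (@edge_point_inner _ _ _ e t ht) /= eqxx xpair_eqE eqxx.
rewrite big1; last first.
  move=> [e' b]; rewrite (@edge_point_inner _ _ _ e t ht) /=.
  by case/andP=> /andP[/eqP->]; case: b; rewrite eqxx.
rewrite addr0 /right_slope /left_slope; lia.
Qed.

Lemma pieces_le e m c sg i j : pieces f e m c sg -> (i <= j < m)%N -> sg j <= sg i.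
Proof.
move=> [hc hp]; elim: j => [|j IH] /andP[ij jm].
  by move: ij; rewrite leqn0 => /eqP->.
move: ij; rewrite leq_eqVlt => /orP[/eqP->//|]; rewrite ltnS => ij.
apply: le_trans (IH _); last by rewrite ij ltnW.
have [h1 _ _] := hp _ jm; have [_ h2 _] := hp _ (ltnW jm).
have [c0 cm cS] := hc.
rewrite -(h1 (c j.+1)); last by rewrite lexx cS.
rewrite -(h2 (c j.+1)); last by rewrite lexx cS// ltnW.
apply: right_slope_le_left; rewrite -{1}c0 -cm.
by rewrite !(cuts_lt hc) ?jm ?leqnn ?(ltnW jm).
Qed.

(** Concavity of [f] along an edge. *)
Lemma left_slope_le_right e t t' : 0 <= t -> t < t' -> t' <= len e ->
  left_slope f e t' <= right_slope f e t.
Proof.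
move=> t0 tt' t'L; have [m [c [sg hp]]] := RatG_pieces e hf.1.
have [hc hq] := hp.
have [|k km hk] := @cuts_locate_right _ m (len e) c t hc; first by lra.
have [|k' k'm hk'] := @cuts_locate_left _ m (len e) c t' hc; first by lra.
have [h1 _ _] := hq _ km; have [_ h2 _] := hq _ k'm.
rewrite h1// h2//; apply: (pieces_le hp); rewrite k'm andbT leqNgt.
apply/negP => kk'.
have : c k'.+1 <= c k by apply: (cuts_le hc); rewrite kk' ltnW.
lra.
Qed.

Lemma pieces_first e m c sg : pieces f e m c sg ->
  dslope f (inl (src e)) (e, false) = sg 0%N.
Proof.
move=> hp; have [hc hq] := hp; have [c0 cm cS] := hc.
have [h1 _ _] := hq _ (pieces_gt0 hp).
rewrite -(h1 0); last by rewrite c0 lexx -[X in X < _]c0 cS// (pieces_gt0 hp).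
by rewrite /right_slope edge_point_src.
Qed.

Lemma pieces_last e m c sg : pieces f e m c sg ->
  dslope f (inl (tgt e)) (e, true) = - sg m.-1.
Proof.
move=> hp; have [hc hq] := hp; have [c0 cm cS] := hc.
have m0 := pieces_gt0 hp.
have mm : (m.-1 < m)%N by rewrite prednK.
have [_ h1 _] := hq _ mm.
rewrite -(h1 (len e)); last by rewrite prednK// cm lexx -[X in _ < X]cm -{2}(prednK m0) cS.
by rewrite /left_slope edge_point_tgt ?opprK.
Qed.

Lemma slope_bounds e t : 0 <= t -> t < len e ->
  - dslope f (inl (tgt e)) (e, true) <= right_slope f e t
  <= dslope f (inl (src e)) (e, false).
Proof.
move=> t0 tL; have [m [c [sg hp]]] := RatG_pieces e hf.1.
have [hc hq] := hp; have m0 := pieces_gt0 hp.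
have [|k km hk] := @cuts_locate_right _ m (len e) c t hc; first by lra.
have [-> // _ _] := hq _ km.
rewrite (pieces_first hp) (pieces_last hp) opprK.
by rewrite !(pieces_le hp)// ?leq0n ?prednK// ?leqnn// andbT -ltnS prednK.
Qed.

Lemma left_slope_bounds e t : 0 < t -> t <= len e ->
  - dslope f (inl (tgt e)) (e, true) <= left_slope f e t
  <= dslope f (inl (src e)) (e, false).
Proof.
move=> t0 tL; have [m [c [sg hp]]] := RatG_pieces e hf.1.
have [hc hq] := hp; have m0 := pieces_gt0 hp.
have [|k km hk] := @cuts_locate_left _ m (len e) c t hc; first by lra.
have [_ -> // _] := hq _ km.
rewrite (pieces_first hp) (pieces_last hp) opprK.
by rewrite !(pieces_le hp)// ?leq0n ?prednK// ?leqnn// andbT -ltnS prednK.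
Qed.

(** The outgoing slope of [f] at the tail of [d]. *)
Definition tail_slope (d : dart G) : int := dslope f (inl (dart_tail d)) d.

Lemma tail_slope_rev d : 0 <= tail_slope d + tail_slope (rev_dart d).
Proof.
have h e : 0 <= tail_slope (e, false) + tail_slope (e, true).
  have /andP[h1 h2] := @slope_bounds e 0 (lexx _) (len0 e).
  by have := le_trans h1 h2; rewrite -subr_ge0 opprK.
by case: d => e [] //; rewrite addrC; exact: h.
Qed.

Lemma tail_slope_sum v : \sum_(d | dart_tail d == v) tail_slope d <= D (inl v).
Proof.
have := hf.2 (inl v); rewrite /ord big_tangent/= subr_ge0.
by under [X in X <= _ -> _]eq_bigr => d /eqP dv do rewrite -dv -/(tail_slope d).
Qed.

(** The increment of [f] along an edge is a positive combination of slopes. *)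
Lemma pieces_increment e m c sg j : pieces f e m c sg -> (j <= m)%N ->
  f (edge_point len e (c j)) - f (edge_point len e (c 0%N))
  = \sum_(0 <= k < j) (sg k)%:~R * (c k.+1 - c k).
Proof.
move=> hp; elim: j => [|j IH] jm; first by rewrite big_geq// subrr.
rewrite big_nat_recr//= -IH ?(ltnW jm)//.
have [_ _ <-] := hp.2 _ jm; ring.
Qed.

Lemma head_ge_tail d : f (inl (dart_tail d)) <= f (inl (dart_head d)) ->
  0 <= tail_slope d.
Proof.
case: d => e b; have [m [c [sg hp]]] := RatG_pieces e hf.1.
have [hc hq] := hp; have m0 := pieces_gt0 hp; have [c0 cm cS] := hc.
have := pieces_increment hp (leqnn m).
rewrite c0 cm (@edge_point_src _ _ len e 0)// (edge_point_tgt len0 (lexx (len e))) /tail_slope.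
case: b => /= hinc ht; rewrite leNgt; last first.
  apply/negP; rewrite (pieces_first hp) => s0.
  suff : \sum_(0 <= k < m) (sg k)%:~R * (c k.+1 - c k) < 0.
    by rewrite -hinc subr_lt0 ltNge ht.
  rewrite -oppr_gt0 -sumrN; apply: sum_nat_gt0 => // k km; rewrite oppr_gt0.
  rewrite nmulr_rlt0 ?subr_gt0 ?cS// ltrz0.
  by apply: le_lt_trans s0; apply: (pieces_le hp).
apply/negP; rewrite (pieces_last hp) oppr_lt0 => s0.
suff : 0 < \sum_(0 <= k < m) (sg k)%:~R * (c k.+1 - c k).
  by rewrite -hinc subr_gt0 ltNge ht.
apply: sum_nat_gt0 => // k km.
rewrite pmulr_rgt0 ?subr_gt0 ?cS// ltr0z.
by apply: lt_le_trans s0 _; apply: (pieces_le hp); rewrite prednK// leqnn andbT -ltnS prednK.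
Qed.

End RatD.
End Slopes.

(** * The slopes of the functions in Rat(D) are bounded *)

Section GraphBound.
Context {R : realType} {G : graph}.
Variables (sg : dart G -> int) (h : vertex G -> R) (Dv : vertex G -> int).
Hypothesis sg_sum : forall v, \sum_(d | dart_tail d == v) sg d <= Dv v.
Hypothesis sg_rev : forall d, 0 <= sg d + sg (rev_dart d).
Hypothesis sg_up : forall d, h (dart_tail d) <= h (dart_head d) -> 0 <= sg d.

Let B : int := \sum_v `|Dv v|.

Lemma sum_tail_le (A : {set vertex G}) : \sum_(d | dart_tail d \in A) sg d <= B.
Proof.
rewrite (partition_big (@dart_tail G) (mem A)) //=.
apply: (@le_trans _ _ (\sum_(v in A) Dv v)).
  apply: ler_sum => v vA; apply: le_trans (sg_sum v).
  rewrite le_eqVlt; apply/orP; left; apply/eqP; apply: eq_bigl => d.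
  by case: eqP => [->|]; rewrite ?vA ?andbF.
apply: (@le_trans _ _ (\sum_(v in A) `|Dv v|)); first by apply: ler_sum => v _; exact: ler_norm.
by rewrite /B [leRHS](bigID (mem A))/= lerDl sumr_ge0.
Qed.

Lemma sum_inside_ge0 (A : {set vertex G}) :
  0 <= \sum_(d | (dart_tail d \in A) && (dart_head d \in A)) sg d.
Proof.
set s := \sum_(_ | _) _.
have : 0 <= s + s.
  rewrite {2}/s (reindex_inj (inv_inj (@rev_dartK G))) /=.
  rewrite [X in _ + X](eq_bigl (fun d : dart G => (dart_tail d \in A) && (dart_head d \in A))).
    by rewrite -big_split/=; apply: sumr_ge0.
  by move=> d; rewrite dart_tail_rev dart_head_rev andbC.
lia.
Qed.

Lemma sg_add_rev_le d : sg d + sg (rev_dart d) <= B.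
Proof.
have := sum_tail_le [set: vertex G].
rewrite (eq_bigl predT) => [|x]; last by rewrite inE.
rewrite (eq_bigr (fun p => sg (p.1, p.2))) => [|[]//].
rewrite -(pair_big predT predT (fun e b => sg (e, b)))/=.
under eq_bigr => e _ do rewrite big_bool /= addrC.
apply: le_trans.
have -> : sg d + sg (rev_dart d) = sg (d.1, false) + sg (d.1, true).
  by case: d => e []//; rewrite addrC.
rewrite (bigD1 d.1)//= lerDl sumr_ge0// => e _; exact: (sg_rev (e, false)).
Qed.

Lemma up_slope_le d : h (dart_tail d) < h (dart_head d) -> sg d <= B.
Proof.
move=> hd.
(* the flow out of a sublevel set *)
pose A := [set v | h v <= h (dart_tail d)]%SET.
apply: le_trans (sum_tail_le A).
rewrite (bigID (fun d => dart_head d \in A))/=.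
rewrite [X in _ <= _ + X](bigD1 d)/=; last by rewrite !inE lexx leNgt hd.
rewrite addrCA lerDl addr_ge0//; first exact: sum_inside_ge0.
apply: sumr_ge0 => d' /andP[/andP[]]; rewrite !inE -ltNge => h1 h2 _.
by apply: sg_up; apply: ltW; apply: le_lt_trans h2.
Qed.

Lemma graph_slope_bound d : `|sg d| <= B.
Proof.
have h1 := sg_add_rev_le d; have h2 := sg_rev d.
have [hd|hd|hd] := ltgtP (h (dart_tail d)) (h (dart_head d)).
- have := up_slope_le hd; have := sg_up (ltW hd); lia.
- have := @up_slope_le (rev_dart d); have := @sg_up (rev_dart d).
  rewrite dart_tail_rev dart_head_rev => /(_ (ltW hd)) h3 /(_ hd) h4; lia.
- have := @sg_up d; rewrite hd lexx => /(_ isT).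
  have := @sg_up (rev_dart d); rewrite dart_tail_rev dart_head_rev hd lexx => /(_ isT).
  lia.
Qed.

End GraphBound.

Section RatDBound.
Context {R : realType} {G : graph}.
Variable len : edge G -> R.
Hypothesis len0 : forall e, 0 < len e.
Variable (D : divisor len).
Hypothesis hD : supported_on_vertices D.

(** An upper bound of the degree of [D] on every set of vertices. *)
Definition slope_bound : int := \sum_(v : vertex G) `|D (inl v)|.

Lemma tail_slope_le f (hf : RatD D f) d : `|tail_slope f d| <= slope_bound.
Proof.
apply: (@graph_slope_bound R G _ (fun v => f (inl v)) (fun v => D (inl v))).
- exact: tail_slope_sum.
- move=> d'; exact: (tail_slope_rev len0 hD hf).
- move=> d'; exact: (head_ge_tail len0 hD hf).
Qed.

Lemma right_slope_le f (hf : RatD D f) e t : 0 <= t -> t < len e ->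
  `|right_slope f e t| <= slope_bound.
Proof.
move=> t0 tL; have := slope_bounds len0 hD hf t0 tL.
have := tail_slope_le hf (e, false); have := tail_slope_le hf (e, true).
rewrite /tail_slope /= !ler_norml => /andP[h1 h2] /andP[h3 h4] /andP[h5 h6].
apply/andP; split; last exact: le_trans h4.
by apply: le_trans h5; rewrite lerN2.
Qed.

Lemma left_slope_le f (hf : RatD D f) e t : 0 < t -> t <= len e ->
  `|left_slope f e t| <= slope_bound.
Proof.
move=> t0 tL; have := left_slope_bounds len0 hD hf t0 tL.
have := tail_slope_le hf (e, false); have := tail_slope_le hf (e, true).
rewrite /tail_slope /= !ler_norml => /andP[h1 h2] /andP[h3 h4] /andP[h5 h6].
apply/andP; split; last exact: le_trans h4.
by apply: le_trans h5; rewrite lerN2.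
Qed.

End RatDBound.

(** * Slope structures are piecewise constant *)

Section RankFunctions.
Variable r : nat.

Lemma standard_rank_ge0 (I : finType) (a : cube r I) :
  0 <= standard_rank a -> standard_rank a = r%:Z - \sum_i (a i)%:Z.
Proof. by rewrite /standard_rank; set s := \sum_i _; lia. Qed.

Lemma standard_rank_function (I : finType) : rank_function (@standard_rank r I).
Proof.
have sum_ge0 (a : cube r I) : 0 <= \sum_i (a i)%:Z by apply: sumr_ge0.
split=> [i t|a b hab|a b|a].
- rewrite /standard_rank (bigD1 i)//= big1 => [|j /negPf ji]; last by rewrite ffunE ji.
  rewrite ffunE eqxx addr0; apply/max_idPr.
  by have := ltn_ord t; lia.
- rewrite /standard_rank.
  have : \sum_i (a i)%:Z <= \sum_i (b i)%:Z by apply: ler_sum => i _; exact: hab.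
  by set s := \sum_i (a i)%:Z; set s' := \sum_i (b i)%:Z; lia.
- rewrite /standard_rank.
  have hs : \sum_i (a i)%:Z + \sum_i (b i)%:Z
    = \sum_i (cube_join a b i)%:Z + \sum_i (cube_meet a b i)%:Z.
    rewrite -!big_split/=; apply: eq_bigr => i _; rewrite !ffunE.
    by case: (leP (a i) (b i)) => // _; rewrite addrC.
  have le_join c : cube_le c (cube_join a b) -> \sum_i (c i)%:Z <= \sum_i (cube_join a b i)%:Z.
    by move=> h; apply: ler_sum => i _; exact: h.
  have h1 : \sum_i (a i)%:Z <= \sum_i (cube_join a b i)%:Z.
    by apply: le_join => i; rewrite ffunE; case: (leP (a i) (b i)).
  have h2 : \sum_i (b i)%:Z <= \sum_i (cube_join a b i)%:Z.
    by apply: le_join => i; rewrite ffunE; case: (leP (a i) (b i)) => // /ltW.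
  move: hs h1 h2.
  set s1 := \sum_i (a i)%:Z; set s2 := \sum_i (b i)%:Z.
  set s3 := \sum_i (cube_join a b i)%:Z; set s4 := \sum_i (cube_meet a b i)%:Z.
  lia.
- rewrite /standard_rank; have := sum_ge0 a; set s := \sum_i _; lia.
Qed.

Variables (I J : finType) (g : I -> J).
Hypothesis g_bij : bijective g.

Lemma standard_rank_reindex (a : cube r J) :
  standard_rank [ffun i => a (g i)] = standard_rank a.
Proof.
rewrite /standard_rank [X in _ = Num.max _ (_ - X)](reindex g)/=; last exact: onW_bij.
by under eq_bigr do rewrite ffunE.
Qed.

Lemma rank_function_reindex (rho : cube r I -> int) (rho' : cube r J -> int) :
  (forall a, rho' a = rho [ffun i => a (g i)]) ->
  rank_function rho -> rank_function rho'.
Proof.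
move=> hr [h1 h2 h3 h4]; have [g' gK g'K] := g_bij.
split=> [j t|a b hab|a b|a].
- rewrite hr -(h1 (g' j) t); congr rho; apply/ffunP => i; rewrite !ffunE.
  by rewrite (can2_eq gK g'K).
- by rewrite !hr; apply: h2 => i; rewrite !ffunE; exact: hab.
- rewrite !hr; apply: le_trans (h3 _ _) _.
  by rewrite le_eqVlt; apply/orP; left; apply/eqP; congr (rho _ + rho _);
    apply/ffunP => i; rewrite !ffunE.
- by rewrite hr; exact: h4.
Qed.

End RankFunctions.

Lemma small_pos3 (R : realFieldType) (a b c : R) : 0 < a -> 0 < b -> 0 < c ->
  exists2 e, 0 < e & [/\ e < a, e < b & e < c].
Proof.
move=> a0 b0 c0; pose m := Num.min a (Num.min b c).
have m0 : 0 < m by rewrite !lt_min a0 b0 c0.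
have me : m / 2 < m by lra.
exists (m / 2); first lra.
by move: me; rewrite {2}/m !lt_min => /andP[? /andP[]].
Qed.

Section SlopeStructure.
Context {r : nat} {R : realType} {G : graph}.
Variable len : edge G -> R.
Hypothesis len0 : forall e, 0 < len e.
Implicit Types (S : slope_data r len) (x : gpoint len) (d : dart G).

(** The slope [sl S] at [x] along the dart [d], as a total function of [d]. *)
Definition dsl S x d (i : 'I_r.+1) : int :=
  if insub d is Some nu then sl S (nu : tangent x) i else 0.

Lemma dslE S x (nu : tangent x) i : dsl S x (val nu) i = sl S nu i.
Proof. by rewrite /dsl valK. Qed.

(** The rank function of [S] at [x] is the standard one. *)
Definition standard_at S x := forall a : cube r (tangent x), rk S a = standard_rank a.

(** Between the distances [u] and [v] from the tail of [d], the slopes of [S]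
    along [d] are [sg], those along the opposite dart are the opposite ones,
    and the rank functions are standard. At the two ends, only the tangent
    direction pointing inside is concerned, and nothing is asked of the rank
    function. *)
Definition slope_run S d (u v : R) (sg : 'I_r.+1 -> int) : Prop :=
  [/\ forall t i, u <= t < v -> dsl S (dart_point len d t) d i = sg i,
      forall t i, u < t <= v ->
        dsl S (dart_point len d t) (rev_dart d) i = - sg (rev_ord i) &
      forall t, u < t < v -> standard_at S (dart_point len d t)].

Lemma slope_run_sub S d u v u' v' sg : u <= u' -> v' <= v ->
  slope_run S d u v sg -> slope_run S d u' v' sg.
Proof.
by move=> uu' vv' [h1 h2 h3]; split=> [t i ht|t i ht|t ht];
  [apply: h1|apply: h2|apply: h3]; lra.
Qed.

Lemma slope_run_rev S d u v sg : slope_run S d u v sg ->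
  slope_run S (rev_dart d) (len d.1 - v) (len d.1 - u) (fun i => - sg (rev_ord i)).
Proof.
move=> [h1 h2 h3]; split=> [t i ht|t i ht|t ht]; rewrite rev_dart_point.
- by rewrite h2//; lra.
- by rewrite rev_dartK rev_ordK opprK h1//; lra.
- by apply: h3; lra.
Qed.

Section Induced.
Variables (H : graph) (lenH : edge H -> R) (phi : gpoint lenH -> gpoint len).
Variables (s : graph_slope_structure r H) (S : slope_data r len).
Hypothesis hind : induced_from phi s S.

Let lenH0 e : 0 < lenH e. Proof. by have [[_ _ h] _ _] := hind. Qed.
Let trans : transports phi (realize s lenH) S. Proof. by have [] := hind. Qed.

Lemma standard_at_inner z p : z = inr p -> standard_at S (phi z).
Proof.
move=> -> a; have [dphi [hb _ _ ->]] := trans (inr p).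
exact: standard_rank_reindex.
Qed.

Lemma starts_at_inner (z : gpoint len) p d d' :
  z = inr p -> starts_at z d -> starts_at z d' -> d' != d -> d' = rev_dart d.
Proof.
move=> -> /eqP; case: d d' => e b [e' b'] /= -> /eqP /= ->.
by rewrite xpair_eqE eqxx/=; case: b b' => [] [].
Qed.

Lemma rev_dart_neq (K : graph) (d : dart K) : rev_dart d != d.
Proof. by case: d => e []; rewrite /rev_dart xpair_eqE/= andbF. Qed.

(** A slope structure induced from [s] has, on a short interval starting at
    any point, the slopes of [s] on the edge of [H] that contains this
    interval. *)
Lemma induced_run (y : gpoint lenH) (nu : tangent (phi y)) :
  exists2 eps, 0 < eps & exists sg,
    let u := dart_pos (phi y) (val nu) in slope_run S (val nu) u (u + eps) sg.
Proof.
have [dphi [[dphi' dK dK'] near_phi sl_phi rk_phi]] := trans y.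
pose mu := dphi' nu.
have [eps1 eps10 h1] := (near0_rightP _).1 (near_phi mu).
set u := dart_pos (phi y) (val nu).
set w := dart_pos y (val mu).
have hu : 0 <= u < len (val nu).1 by apply: dart_pos_bound => //; exact: valP.
have hw : 0 <= w < lenH (val mu).1 by apply: dart_pos_bound => //; exact: valP.
have {}h1 t : 0 < t < eps1 ->
    phi (dart_point lenH (val mu) (w + t)) = dart_point len (val nu) (u + t).
  by move=> /h1; rewrite !move_alongE dK'.
have /andP[u0 uL] := hu; have /andP[w0 wL] := hw.
have uL' := uL; have wL' := wL; rewrite -subr_gt0 in uL'; rewrite -subr_gt0 in wL'.
have [eps eps0 [e1 e2 e3]] := small_pos3 eps10 uL' wL'.
exists eps => //.
exists (gslope s (val mu)) => /=.
have claim t : 0 < t <= eps ->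
  [/\ forall i, dsl S (dart_point len (val nu) (u + t)) (val nu) i = gslope s (val mu) i,
      forall i, dsl S (dart_point len (val nu) (u + t)) (rev_dart (val nu)) i
                = - gslope s (val mu) (rev_ord i) &
      standard_at S (dart_point len (val nu) (u + t))].
  move=> ht; rewrite -h1; last lra.
  set z := dart_point lenH (val mu) (w + t).
  have hz : exists p, z = inr p.
    rewrite /z /dart_point edge_point_inner/=; first by case: (val mu).2; lra.
    by move=> hp; eexists.
  have [p zp] := hz.
  have hpz : exists p, phi z = inr p.
    rewrite h1; last lra.
    rewrite /dart_point edge_point_inner/=; first by case: (val nu).2; lra.
    by move=> hp; eexists.
  have [q zq] := hpz.
  have hwt : 0 <= w + t < lenH (val mu).1 by lra.
  have hut : 0 <= u + t < len (val nu).1 by lra.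
  have smu : starts_at z (val mu) by apply: starts_at_dart_point.
  have smu' : starts_at z (rev_dart (val mu)) by move: smu; rewrite zp.
  pose mu2 : tangent z := Sub (val mu) smu.
  pose mu3 : tangent z := Sub (rev_dart (val mu)) smu'.
  have [dphi2 [bij2 near2 sl2 rk2]] := trans z.
  have snu : starts_at (phi z) (val nu).
    by rewrite h1; [apply: starts_at_dart_point|lra].
  (* The differential of [phi] at [z] agrees with the direction in which
     [phi] moves [z] away from [phi y]. *)
  have dphi2_mu2 : val (dphi2 mu2) = val nu.
    apply/eqP; apply: contraT => hne.
    have hrev := starts_at_inner zq snu (valP (dphi2 mu2)) hne.
    have [eps2 eps20 h2] := (near0_rightP _).1 (near2 mu2).
    have p1 : 0 < eps1 - t by lra.
    have p2 : 0 < len (val nu).1 - u - t by lra.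
    have [v v0 [v2 v1 v3]] := small_pos3 eps20 p1 p2.
    have hpos : dart_pos (phi z) (rev_dart (val nu)) = len (val nu).1 - (u + t).
      rewrite h1; last lra.
      have -> : dart_point len (val nu) (u + t)
          = dart_point len (rev_dart (val nu)) (len (val nu).1 - (u + t)).
        by rewrite rev_dart_point subKr.
      by rewrite dart_posE//=; lra.
    have := h2 v; rewrite v0 v2 => /(_ isT).
    rewrite !move_alongE hrev hpos /= dart_posE// -addrA h1; last lra.
    rewrite rev_dart_point.
    case/dart_point_inj => //; first lra.
    by move=> _; rewrite eqxx; lra.
  have dphi2_mu3 : val (dphi2 mu3) = rev_dart (val nu).
    apply: (starts_at_inner zq snu (valP _)).
    rewrite -dphi2_mu2 (inj_eq val_inj) (inj_eq (bij_inj bij2)).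
    by rewrite -(inj_eq val_inj)/= rev_dart_neq.
  split=> [i|i|]; last exact: (standard_at_inner zp).
  - by rewrite -dphi2_mu2 dslE sl2.
  - rewrite -dphi2_mu3 dslE sl2/=.
    by have /eqP := gslope_rev s (val mu) (rev_ord i);
      rewrite rev_ordK addrC addr_eq0 => /eqP.
split=> [t i ht|t i ht|t ht].
- have [h|h] := eqVneq t u.
    by rewrite h /u dart_point_pos//; [rewrite dslE -[nu in LHS]dK' sl_phi|exact: valP].
  have h' : u < t by rewrite lt_neqAle eq_sym h; case/andP: ht.
  have tu : 0 < t - u <= eps by lra.
  by have [<- _ _] := claim _ tu; rewrite subrKC.
- have tu : 0 < t - u <= eps by lra.
  by have [_ <- _] := claim _ tu; rewrite subrKC.
- have tu : 0 < t - u <= eps by lra.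
  by have [_ _] := claim _ tu; rewrite subrKC.
Qed.

End Induced.

Variable S : slope_data r len.
Hypothesis hS : slope_structure S.

Lemma sl_incr x (nu : tangent x) (i j : 'I_r.+1) : (i < j)%N -> sl S nu i < sl S nu j.
Proof.
have [H [lenH [phi [s [_ [[phi' pK pK'] _] htr]]]]] := hS.
move=> ij; rewrite -(pK' x) in nu *.
have [dphi [[dphi' dK dK'] _ hsl _]] := htr (phi' x).
by rewrite -(dK' nu) !hsl /=; apply: gslope_incr.
Qed.

Lemma slope_run_incr e u v sg (i j : 'I_r.+1) : slope_run S (e, false) u v sg ->
  0 <= u < v -> v <= len e -> (i < j)%N -> sg i < sg j.
Proof.
move=> [h1 _ _] huv vL ij.
have hu : 0 <= u < len (e, false).1 by rewrite /=; lra.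
have hd := starts_at_dart_point len0 hu.
have := sl_incr (Sub (e, false) hd : tangent (dart_point len (e, false) u)) ij.
by rewrite -!dslE /= !h1//; lra.
Qed.

Lemma rk_rank x : rank_function (@rk r R G len S x).
Proof.
have [H [lenH [phi [s [_ [[phi' pK pK'] _] htr]]]]] := hS.
rewrite -(pK' x); have [dphi [hb _ _ hrk]] := htr (phi' x).
apply: (rank_function_reindex hb hrk).
case: (phi' x) => [v|p] /=; first exact: grank_rank.
exact: standard_rank_function.
Qed.

Lemma local_run d u : 0 <= u < len d.1 ->
  exists2 eps, 0 < eps & exists sg, slope_run S d u (u + eps) sg.
Proof.
move=> hu; have [H [lenH [phi [s hind]]]] := hS.
have [_ [[phi' pK pK'] _] _] := hind.
pose y := phi' (dart_point len d u).
have hy : phi y = dart_point len d u by rewrite pK'.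
have hd : starts_at (phi y) d by rewrite hy; apply: starts_at_dart_point.
have [eps eps0 [sg]] := induced_run hind (Sub d hd : tangent (phi y)).
by rewrite /= hy dart_posE//; exists eps => //; exists sg.
Qed.

(** A slope structure is constant on the intervals of a finite subdivision of
    each edge, with standard rank functions inside of these intervals. *)
Lemma slope_structure_cuts e : exists m c, cuts m (len e) c /\
  forall k, (k < m)%N -> exists sg, slope_run S (e, false) (c k) (c k.+1) sg.
Proof.
apply: (local_cuts (Q := fun u v => exists sg, slope_run S (e, false) u v sg)) => //.
- move=> t ht; have [eps eps0 [sg hsg]] := @local_run (e, false) t ht.
  exists eps => // u hu; exists sg; apply: slope_run_sub hsg => //; lra.
- move=> t ht; have [|eps eps0 [sg hsg]] := @local_run (e, true) (len e - t); first by rewrite /=; lra.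
  exists eps => // u hu; have := slope_run_rev hsg => /=.
  rewrite subKr => h; eexists; apply: slope_run_sub h; lra.
Qed.

End SlopeStructure.

(** * Slope structures of admissible semimodules *)

Section TwoDirections.
Variables (r : nat) (I : finType) (p q : I).
Hypotheses (pq : p != q) (Ipq : forall i, i = p \/ i = q).
Variable rho : cube r I -> int.
Hypothesis hrho : rank_function rho.

(* The point of the square with coordinates [x] along [p] and [y] along [q]. *)
Let pt (x y : nat) : cube r I := [ffun k => if k == q then inord y else inord x].

Let pt_p x y : pt x y p = inord x. Proof. by rewrite ffunE (negPf pq). Qed.
Let pt_q x y : pt x y q = inord y. Proof. by rewrite ffunE eqxx. Qed.

Let ptE (a : cube r I) : a = pt (a p) (a q).
Proof.
by apply/ffunP => i; case: (Ipq i) => ->; rewrite ?pt_p ?pt_q inord_val.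
Qed.

Let rho_p (x : nat) : (x <= r)%N -> rho (pt x 0) = r%:Z - x%:Z.
Proof.
move=> xr; have [h1 _ _ _] := hrho; have := h1 p (inord x).
rewrite inordK// => <-; congr rho; apply/ffunP => i.
case: (Ipq i) => ->; rewrite !ffunE !eqxx ?(negPf pq)//.
by rewrite eq_sym (negPf pq); apply: val_inj; rewrite /= inordK.
Qed.

Let rho_q (x : nat) : (x <= r)%N -> rho (pt 0 x) = r%:Z - x%:Z.
Proof.
move=> xr; have [h1 _ _ _] := hrho; have := h1 q (inord x).
rewrite inordK// => <-; congr rho; apply/ffunP => i.
case: (Ipq i) => ->; rewrite !ffunE ?eqxx ?(negPf pq)//.
by apply: val_inj; rewrite /= inordK.
Qed.

Let supermodular x y x' y' : (x <= r)%N -> (y <= r)%N -> (x' <= r)%N -> (y' <= r)%N ->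
  (x' <= x)%N -> (y <= y')%N ->
  rho (pt x y) + rho (pt x' y') <= rho (pt x y') + rho (pt x' y).
Proof.
move=> xr yr x'r y'r hx hy; have [_ _ h3 _] := hrho.
have := h3 (pt x y) (pt x' y').
have -> : cube_join (pt x y) (pt x' y') = pt x y'.
  apply/ffunP => i; rewrite ffunE; case: (Ipq i) => ->; rewrite ?pt_p ?pt_q;
  apply: val_inj; rewrite maxEle leEord !inordK//; last by rewrite hy /= inordK.
  by case: leqP => h; rewrite /= ?inordK//; apply/eqP; rewrite eqn_leq hx h.
have -> // : cube_meet (pt x y) (pt x' y') = pt x' y.
apply/ffunP => i; rewrite ffunE; case: (Ipq i) => ->; rewrite ?pt_p ?pt_q;
apply: val_inj; rewrite minEle leEord !inordK//; last by rewrite hy /= inordK.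
by case: leqP => h; rewrite /= ?inordK//; apply/eqP; rewrite eqn_leq hx h.
Qed.

Let succ_p x y : (x < r)%N -> cube_succ (pt x y) p = pt x.+1 y.
Proof.
move=> xr; apply/ffunP => i; rewrite ffunE.
have xr' : (x < r.+1)%N := ltnW xr.
case: (Ipq i) => ->; rewrite ?pt_p ?pt_q ?eqxx ?(inordK xr')//.
by rewrite eq_sym (negPf pq).
Qed.

Let succ_q x y : (y < r)%N -> cube_succ (pt x y) q = pt x y.+1.
Proof.
move=> yr; apply/ffunP => i; rewrite ffunE.
have yr' : (y < r.+1)%N := ltnW yr.
by case: (Ipq i) => ->; rewrite ?pt_p ?pt_q ?eqxx ?(inordK yr') ?(negPf pq).
Qed.

(** On a square, the standard rank function is the only one having the whole
    antidiagonal among its jumps. *)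
Lemma standard_of_jumps :
  (forall i : 'I_r.+1, jump rho [ffun k => if k == q then i else rev_ord i]) ->
  forall a, rho a = standard_rank a.
Proof.
move=> hj.
have {}hj i : (i <= r)%N -> jump rho (pt (r - i) i).
  move=> ir; have := hj (inord i); congr (jump rho _); apply/ffunP => k.
  rewrite !ffunE; case: eqP => // _; apply: val_inj.
  by rewrite /= !inordK// ?subSS ?ltnS ?leq_subr.
have [_ mono _ bound] := hrho.
(* Two neighbours on the antidiagonal have the same successor. *)
have diag i : (i <= r)%N -> rho (pt (r - i) i) = 0.
  elim: i => [|i IH] ir; first by rewrite subn0 rho_p ?subrr.
  have [_ /(_ q)] := hj i (ltnW ir); rewrite pt_q inordK ?ltnS ?(ltnW ir)// => /(_ ir).
  rewrite succ_q// (IH (ltnW ir)) => h1.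
  have [_ /(_ p)] := hj i.+1 ir; rewrite pt_p inordK ?ltnS ?leq_subr//.
  have h : (r - i.+1 < r)%N by lia.
  move=> /(_ h); rewrite succ_p// subnSK// h1; lia.
move=> a; rewrite [a in LHS]ptE /standard_rank.
have -> : \sum_i (a i)%:Z = (a p)%:Z + (a q)%:Z.
  rewrite (bigD1 p)//= (bigD1 q)/=; last by rewrite eq_sym.
  rewrite big1 ?addr0// => i /andP[]; case: (Ipq i) => ->; by rewrite eqxx.
have := ltn_ord (a p); have := ltn_ord (a q).
move: (a p : nat) (a q : nat) => x y; rewrite !ltnS => yr xr.
have [hxy|hxy] := leqP (x + y) r.
  have h1 : rho (pt x y) + rho (pt 0 (r - x)) <= rho (pt x (r - x)) + rho (pt 0 y).
    by apply: supermodular => //; lia.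
  have h2 : rho (pt x 0) + rho (pt 0 y) <= rho (pt x y) + rho (pt 0 0).
    by apply: supermodular.
  have h3 : rho (pt x (r - x)) = 0.
    by have := diag (r - x)%N; rewrite subKn// => ->//; exact: leq_subr.
  move: h1 h2; rewrite h3 !rho_q ?rho_p// ?leq_subr//; lia.
have [_ /(_ q)] := hj (r - x)%N (leq_subr _ _).
rewrite diag ?leq_subr// subKn// pt_q inordK ?ltnS ?leq_subr//.
have h : (r - x < r)%N by lia.
move=> /(_ h); rewrite succ_q// => h1.
have : rho (pt x y) <= rho (pt x (r - x).+1).
  apply: mono => i; case: (Ipq i) => ->; rewrite ?pt_p ?pt_q// !inordK//; lia.
have /andP[+ _] := bound (pt x y); rewrite h1; lia.
Qed.

End TwoDirections.

Section Admissible.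
Context {r : nat} {R : realType} {G : graph}.
Variable len : edge G -> R.
Hypothesis len0 : forall e, 0 < len e.

(** The divisor [i x + j y], where [x] and [y] may be equal. *)
Lemma two_point_divisor (x y : gpoint len) (i j : nat) :
  exists E : divisor len,
    [/\ effective E, degree E = (i + j)%:Z, i%:Z <= E x & j%:Z <= E y].
Proof.
pose g (z : gpoint len) (k : nat) (w : gpoint len) : int := if `[< w = z >] then k%:Z else 0.
have gz z k : g z k z = k%:Z by rewrite /g; case: asboolP.
have gn z k w : w <> z -> g z k w = 0 by rewrite /g; case: asboolP.
have g0 z k w : 0 <= g z k w by rewrite /g; case: asboolP.
have fin : finite_set [set w | g x i w + g y j w != 0].
  apply: (@sub_finite_set _ _ ([set x] `|` [set y])); last by rewrite finite_setU.
  move=> w /=; apply: contra_neqP => /not_orP[/gn -> /gn ->]; by rewrite addr0.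
exists (Divisor fin); split => /=.
- by move=> w /=; rewrite addr_ge0.
- rewrite /degree /=.
  rewrite -(@fsbig_widen _ _ _ _ ([set x] `|` [set y]) setT) //; last first.
    by move=> w [_ /= /not_orP[/gn -> /gn ->]]; rewrite addr0.
  rewrite fsbig_split/=; last by rewrite finite_setU.
  have sum1 z k A : A z -> \sum_(w \in A) g z k w = k%:Z.
    move=> Az; have sA : [set z] `<=` A by move=> w ->.
    rewrite -(fsbig_widen _ _ _ sA) ?fsbig_set1 ?gz//.
    by move=> w [_ /= /gn ->].
  by rewrite !sum1 ?PoszD//; [right|left].
- by rewrite gz lerDl.
- by rewrite gz lerDr.
Qed.

Lemma starts_at_edge_point e t b : 0 < t < len e -> starts_at (edge_point len e t) (e, b).
Proof. by move=> ht; rewrite (@edge_point_inner _ _ _ e t ht) /= eqxx. Qed.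

Lemma edge_point_starts_at e t d : 0 < t < len e -> starts_at (edge_point len e t) d ->
  d = (e, false) \/ d = (e, true).
Proof.
move=> ht; rewrite (@edge_point_inner _ _ _ e t ht) /=.
by case: d => e' [] /= /eqP ->; [right|left].
Qed.

Variable D : divisor len.
Hypothesis hD : supported_on_vertices D.
Variables (M : set (gpoint len -> R)) (S : slope_data r len).
Hypothesis hM : admissible D M S.

Let hS : slope_structure S. Proof. by case: hM. Qed.
Let MD f : M f -> RatD D f. Proof. by case: hM => _ _ _ h _ /h[]. Qed.
Let Mcompat f : M f -> compatible S f. Proof. by case: hM => _ _ _ h _ /h[]. Qed.

(** Where the rank functions are standard, a rank at least [k] forces the two
    slopes of [f] to be [sg q] and [sg (r - p)] with [p + q <= r - k]. *)
Lemma run_slopes e u v sg f t (a : cube r (tangent (edge_point len e t))) (k : nat) :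
  slope_run S (e, false) u v sg -> 0 <= u -> v <= len e -> u < t < v ->
  slopes_at S f a -> k%:Z <= rk S a ->
  exists p q : 'I_r.+1,
    [/\ right_slope f e t = sg q, left_slope f e t = sg (rev_ord p)
      & (p + q + k <= r)%N].
Proof.
move=> [h1 h2 h3] u0 vL ht [_ hsl].
have ht0 : 0 < t < len e by lra.
pose nuF : tangent (edge_point len e t) := Sub (e, false) (starts_at_edge_point false ht0).
pose nuB : tangent (edge_point len e t) := Sub (e, true) (starts_at_edge_point true ht0).
rewrite (h3 t ht) => hk; exists (a nuB), (a nuF); split.
- rewrite -(h1 t); last lra.
  by rewrite /right_slope (dslopeE f nuF) hsl -dslE.
- rewrite /left_slope (dslopeE f nuB) hsl -dslE.
  have -> : dsl S (edge_point len e t) (val nuB) (a nuB) = - sg (rev_ord (a nuB)).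
    by apply: (h2 t); lra.
  by rewrite opprK.
- move: (hk); rewrite standard_rank_ge0; last exact: le_trans hk.
  rewrite (bigD1 nuF)//= (bigD1 nuB)/=; last first.
    by rewrite -(inj_eq val_inj) xpair_eqE andbF.
  set s : int := \sum_(_ | _) _.
  have : 0 <= s by apply: sumr_ge0.
  move: (a nuF : nat) (a nuB : nat) => x y; clearbody s; clear -s; lia.
Qed.

Lemma run_le e u v sg (i j : 'I_r.+1) : slope_run S (e, false) u v sg ->
  0 <= u < v -> v <= len e -> (i <= j)%N -> sg i <= sg j.
Proof.
move=> hr huv vL; rewrite leq_eqVlt => /orP[/eqP/val_inj->//|ij].
exact: ltW (slope_run_incr len0 hS hr huv vL ij).
Qed.

Lemma run_bound e u v sg i : slope_run S (e, false) u v sg ->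
  0 <= u < v -> v <= len e -> `|sg i| <= slope_bound D.
Proof.
move=> hr huv vL; pose t := (u + v) / 2.
have htu : u < t < v by rewrite /t; lra.
have [E [E0 degE E1 _]] := two_point_divisor (edge_point len e t) (edge_point len e t) r 0.
have [_ _ _ _ /(_ E E0)] := hM; rewrite degE addn0 => /(_ erefl)[f [Mf hf _]].
have [a ha hE] := hf (edge_point len e t).
have u0 : 0 <= u by lra.
have [p [q [hq hp hpq]]] := run_slopes hr u0 vL htu ha (le_trans E1 hE).
have p0 : p = ord0 by apply: val_inj => /=; lia.
have q0 : q = ord0 by apply: val_inj => /=; lia.
have := @right_slope_le _ _ _ len0 _ hD f (MD Mf) e t; rewrite hq q0.
have := @left_slope_le _ _ _ len0 _ hD f (MD Mf) e t; rewrite hp p0.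
have i0 : sg ord0 <= sg i by apply: (run_le hr).
have ir : sg i <= sg (rev_ord ord0).
  by apply: (run_le hr) => //=; have := ltn_ord i; lia.
have t0 : 0 < t by lra.
have tL : t < len e by lra.
move=> /(_ t0 (ltW tL)) h1 /(_ (ltW t0) tL); lia.
Qed.

(** The function that [M] provides for the divisor [(r - i) y + i z], where
    [y] is on the left of [t] and [z] on its right, has by concavity its slopes
    at [t] squeezed between those of [S]. *)
Lemma squeeze e u t v sg sg' i :
  slope_run S (e, false) u t sg -> slope_run S (e, false) t v sg' ->
  0 <= u < t -> t < v <= len e ->
  exists2 f, M f &
    [/\ sg' i <= right_slope f e t, right_slope f e t <= left_slope f e t
      & left_slope f e t <= sg i].
Proof.
move=> hr hr' hut htv.
pose y := (u + t) / 2; pose z := (t + v) / 2.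
have hy : u < y < t by rewrite /y; lra.
have hz : t < z < v by rewrite /z; lra.
have ri : (i <= r)%N by rewrite -ltnS.
have [E [E0 degE Ey Ez]] :=
  two_point_divisor (edge_point len e y) (edge_point len e z) (r - i) i.
have [_ _ _ _ /(_ E E0)] := hM; rewrite degE subnK// => /(_ erefl)[f [Mf hf _]].
exists f => //; split.
- have [a ha hE] := hf (edge_point len e z).
  have [||p [q [_ hp hpq]]] := run_slopes hr' _ _ hz ha (le_trans Ez hE); [lra|lra|].
  apply: (@le_trans _ _ (left_slope f e z)).
    by rewrite hp; apply: (run_le hr') => /=; [lra|lra|lia].
  by apply: (left_slope_le_right len0 hD (MD Mf)); lra.
- by apply: (right_slope_le_left hD (MD Mf)); lra.
- have [a ha hE] := hf (edge_point len e y).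
  have [||p [q [hq _ hpq]]] := run_slopes hr _ _ hy ha (le_trans Ey hE); [lra|lra|].
  apply: (@le_trans _ _ (right_slope f e y)).
    by apply: (left_slope_le_right len0 hD (MD Mf)); lra.
  by rewrite hq; apply: (run_le hr) => /=; [lra|lra|lia].
Qed.

(** The slopes of [S] do not increase along an edge. *)
Lemma run_noninc e u t v sg sg' i :
  slope_run S (e, false) u t sg -> slope_run S (e, false) t v sg' ->
  0 <= u < t -> t < v <= len e -> sg' i <= sg i.
Proof.
move=> hr hr' hut htv; have [f _ [h1 h2 h3]] := squeeze i hr hr' hut htv.
exact: le_trans h1 (le_trans h2 h3).
Qed.

(** If the slopes agree on both sides of [t], then [S] is smooth at [t]. *)
Lemma run_merge e u t v sg sg' :
  slope_run S (e, false) u t sg -> slope_run S (e, false) t v sg' ->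
  0 <= u < t -> t < v <= len e -> (forall i, sg' i = sg i) ->
  slope_run S (e, false) u v sg.
Proof.
move=> hr hr' hut htv hsg.
have [h1 h2 h3] := hr; have [h1' h2' h3'] := hr'.
split=> [w i hw|w i hw|w hw].
- have [wt|wt] := ltP w t; first by apply: h1; lra.
  by rewrite h1' ?hsg//; lra.
- have [wt|wt] := leP w t; first by apply: h2; lra.
  by rewrite h2' ?hsg//; lra.
have [wt|wt|->] := ltgtP w t; [by apply: h3; lra|by apply: h3'; lra|].
have ht : 0 < t < len e by lra.
pose nuF : tangent (edge_point len e t) := Sub (e, false) (starts_at_edge_point false ht).
pose nuB : tangent (edge_point len e t) := Sub (e, true) (starts_at_edge_point true ht).
have sg_inj : injective sg.
  have tL : t <= len e by lra.
  move=> i j hij; apply: val_inj; case: (ltngtP i j) => // ij.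
    by have := slope_run_incr len0 hS hr hut tL ij; rewrite hij ltxx.
  by have := slope_run_incr len0 hS hr hut tL ij; rewrite hij ltxx.
apply: (@standard_of_jumps _ _ nuB nuF) => //.
- by rewrite -(inj_eq val_inj) xpair_eqE andbF.
- case=> d hd; case: (edge_point_starts_at ht hd) => hde; [right|left];
  exact: val_inj.
- exact: (rk_rank hS).
move=> i; have [f Mf [k1 k2 k3]] := squeeze i hr hr' hut htv.
have [_ [a [ja sa]]] := Mcompat Mf (edge_point len e t).
suff -> : [ffun k => if k == nuF then i else rev_ord i] = a by [].
have hR : right_slope f e t = sg i by apply/le_anti; rewrite -{2}hsg k1 (le_trans k2 k3).
have hL : left_slope f e t = sg i by apply/le_anti; rewrite k3 -hR k2.
have aF : a nuF = i.
  apply: sg_inj; rewrite -hR /right_slope (dslopeE f nuF) sa -dslE.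
  by have := h1' t (a nuF); rewrite hsg => <-//; lra.
have aB : a nuB = rev_ord i.
  apply: (canRL rev_ordK); apply: sg_inj.
  rewrite -hL /left_slope (dslopeE f nuB) sa -dslE.
  have -> : dsl S (edge_point len e t) (val nuB) (a nuB) = - sg (rev_ord (a nuB)).
    by apply: (h2 t); lra.
  by rewrite opprK.
apply/ffunP => -[d hd]; rewrite ffunE.
case: (edge_point_starts_at ht hd) => hde.
  have -> : exist _ d hd = nuF by apply: val_inj.
  by rewrite eqxx.
have -> : exist _ d hd = nuB by apply: val_inj.
by rewrite -(inj_eq val_inj) xpair_eqE/= andbF.
Qed.

End Admissible.

(** * A bound on the number of pieces *)

Section RefineCuts.
Context {R : realType}.
Variables (Q : R -> R -> Prop) (L : R).
Hypothesis L0 : 0 < L.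

Let good m := exists c, cuts m L c /\ forall k, (k < m)%N -> Q (c k) (c k.+1).

Lemma refine_cuts m n : (forall u v u' v', u <= u' -> v' <= v -> Q u v -> Q u' v') ->
  good m -> (m <= n)%N -> good n.
Proof.
move=> Qsub gm; elim: n => [|n IH]; first by rewrite leqn0 => /eqP <-.
rewrite leq_eqVlt => /orP[/eqP <-//|]; rewrite ltnS => /IH[c [hc cQ]].
have n0 := cuts_gt0 L0 hc; have [c0 cn cS] := hc.
case: n n0 {IH} hc cn cS cQ => // n _ hc cn cS cQ.
have cnn := cS n (ltnSn n); have Qn := cQ n (ltnSn n).
pose c' k := if (k <= n)%N then c k else if k == n.+1 then (c n + c n.+1) / 2 else c n.+1.
have c'l k : (k <= n)%N -> c' k = c k by rewrite /c' => ->.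
have c'1 : c' n.+1 = (c n + c n.+1) / 2 by rewrite /c' ltnn eqxx.
have c'2 : c' n.+2 = c n.+1.
  by rewrite /c' ifF ?ifF//; lia.
exists c'; split; first split.
- by rewrite c'l.
- by rewrite c'2.
- move=> k; rewrite ltnS leq_eqVlt => /orP[/eqP->|]; first by rewrite c'1 c'2; lra.
  rewrite ltnS leq_eqVlt => /orP[/eqP->|kn]; first by rewrite c'l// c'1; lra.
  by rewrite !c'l ?cS// ltnW.
move=> k; rewrite ltnS leq_eqVlt => /orP[/eqP->|].
  by rewrite c'1 c'2; apply: Qsub Qn; lra.
rewrite ltnS leq_eqVlt => /orP[/eqP->|kn].
  by rewrite c'l// c'1; apply: Qsub Qn; lra.
by rewrite !c'l//; [apply: cQ; rewrite ltnW|rewrite ltnW].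
Qed.

(** Removing the cut [c j.+1] from a subdivision. *)
Lemma drop_cut m c j : cuts m.+1 L c ->
  (forall k, (k < m.+1)%N -> Q (c k) (c k.+1)) ->
  (j < m)%N -> Q (c j) (c j.+2) -> good m.
Proof.
move=> hc cQ jm Qj; have [c0 cn cS] := hc.
exists (fun k => if (k <= j)%N then c k else c k.+1); split; first split.
- by rewrite leq0n.
- by rewrite leqNgt jm.
- move=> k km; case: (ltngtP k j) => [kj|jk|->] /=.
  + by rewrite cS// ltnW.
  + by rewrite cS.
  + by apply: (cuts_lt hc); rewrite ltnW//= ltnS.
- move=> k km; case: (ltngtP k j) => [kj|jk|->] //=.
  + by apply: cQ; rewrite ltnW.
  + by apply: cQ.
Qed.

End RefineCuts.

Section AdmissibleCuts.
Context {r : nat} {R : realType} {G : graph}.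
Variable len : edge G -> R.
Hypothesis len0 : forall e, 0 < len e.
Variable D : divisor len.
Hypothesis hD : supported_on_vertices D.

(** A number of pieces that suffices on each edge. The sum of the [r.+1]
    slopes, each of absolute value at most [slope_bound D], decreases strictly
    at each necessary cut, so that [2 * (r.+1 * slope_bound D) + 1] pieces are
    enough; at least three pieces make the subdivided graph simple. *)
Definition piece_bound : nat := (2 * (r.+1 * `|slope_bound D|)).+3.

Lemma slope_bound_ge0 : 0 <= slope_bound D.
Proof. exact: sumr_ge0. Qed.

Variables (M : set (gpoint len -> R)) (S : slope_data r len).
Hypothesis hM : admissible D M S.

Lemma admissible_cuts e : exists c, cuts piece_bound (len e) c /\
  forall k, (k < piece_bound)%N -> exists sg, slope_run S (e, false) (c k) (c k.+1) sg.
Proof.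
pose Q u v := exists sg, slope_run S (e, false) u v sg.
pose good m := exists c, cuts m (len e) c /\ forall k, (k < m)%N -> Q (c k) (c k.+1).
have ex_good : exists m, `[< good m >].
  have hS : slope_structure S by case: hM.
  by have [m hm] := slope_structure_cuts len0 hS e; exists m; apply/asboolP.
(* In a subdivision with as few pieces as possible, no cut can be dropped. *)
have [m /asboolP gm mmin] := ex_minnP ex_good.
have Qsub u v u' v' : u <= u' -> v' <= v -> Q u v -> Q u' v'.
  by move=> uu' vv' [sg hsg]; exists sg; apply: slope_run_sub hsg.
apply: (refine_cuts (len0 e) Qsub gm).
have [c [hc cQ]] := gm; have m0 := cuts_gt0 (len0 e) hc.
case: m m0 mmin {gm} hc cQ => // m _ mmin hc cQ.
have : forall k, exists sg, (k < m.+1)%N -> slope_run S (e, false) (c k) (c k.+1) sg.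
  move=> k; case: (boolP (k < m.+1)%N) => [/cQ[sg hsg]|_]; first by exists sg.
  by exists (fun=> 0).
case/choice => sg hsg.
have [_ _ cS] := hc.
have cb k : (k <= m.+1)%N -> 0 <= c k <= len e by exact: cuts_bound hc.
pose Phi k : int := \sum_(i < r.+1) sg k i.
have Phi_decr k : (k < m)%N -> Phi k.+1 < Phi k.
  move=> km; have km1 : (k < m.+1)%N by exact: ltnW.
  have hk : 0 <= c k < c k.+1 by rewrite cS// andbT; have /andP[] := cb k (ltnW km1).
  have hk' : c k.+1 < c k.+2 <= len e by rewrite cS//; have /andP[] := cb k.+2 km.
  have le_sg i : sg k.+1 i <= sg k i.
    exact: (run_noninc len0 hD hM i (hsg k km1) (hsg k.+1 km) hk hk').
  rewrite lt_neqAle ler_sum//= andbT; apply/negP => /eqP hPhi.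
  have sg_eq i : sg k.+1 i = sg k i.
    apply/eqP; rewrite eq_sym -subr_eq0.
    have : \sum_(i < r.+1) (sg k i - sg k.+1 i) = 0.
      by rewrite sumrB -/(Phi k) -/(Phi k.+1) hPhi subrr.
    move/eqP; rewrite psumr_eq0 => [/allP/(_ i)|j _]; last by rewrite subr_ge0.
    by rewrite mem_index_enum => /(_ isT).
  have hmerge := run_merge len0 hD hM (hsg k km1) (hsg k.+1 km) hk hk' sg_eq.
  have := mmin m; rewrite ltnn => h; suff : false by [].
  by apply: h; apply/asboolP; apply: (drop_cut hc cQ km); exists (sg k).
have Phi_bound k : (k < m.+1)%N -> `|Phi k| <= (r.+1 * `|slope_bound D|)%:Z.
  move=> km; apply: le_trans (ler_norm_sum _ _ _) _.
  apply: (@le_trans _ _ (\sum_(i < r.+1) slope_bound D)).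
    apply: ler_sum => i _; apply: (run_bound len0 hD hM i (hsg k km)).
      by rewrite cS// andbT; have /andP[] := cb k (ltnW km).
    by have /andP[] := cb k.+1 km.
  by rewrite sumr_const card_ord PoszM gez0_abs ?slope_bound_ge0// -mulr_natl natz.
have Phi_le k : (k <= m)%N -> Phi k + k%:Z <= Phi 0%N.
  elim: k => [|k IH] km; first by rewrite addr0.
  by have := Phi_decr k km; have := IH (ltnW km); lia.
have := Phi_le m (leqnn m); have := Phi_bound 0%N isT; have := Phi_bound m (ltnSn m).
rewrite /piece_bound; move: (r.+1 * _)%N (Phi m) (Phi 0%N) => *; lia.
Qed.

End AdmissibleCuts.

(** * Subdivisions of a graph *)

Lemma inj_surj_bijective (A B : Type) (f : A -> B) :
  injective f -> (forall b, exists a, f a = b) -> bijective f.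
Proof.
move=> finj /choice[g gK]; exists g => // a; apply: finj; exact: gK.
Qed.

Section SubdivisionGraph.
Context {G : graph}.
Variable n : edge G -> nat.
Local Notation H := (subdivision n).

Lemma node_last e : node n e (n e).+1 = inl (tgt e).
Proof. by rewrite /= insubF// ltnn. Qed.

Lemma node_inner e k (hk : (k < n e)%N) :
  node n e k.+1 = inr (existT (fun e' => 'I_(n e')) e (Ordinal hk)).
Proof. by rewrite /= insubT. Qed.

(** Two nodes agree only if they are the same inner node, or if both of them
    are vertices of [G]. *)
Lemma node_eq e e' j j' : (j <= (n e).+1)%N -> (j' <= (n e').+1)%N ->
  node n e j = node n e' j' ->
  [/\ (0 < j <= n e)%N, e = e' & j = j'] \/
  (~~ (0 < j <= n e)%N /\ ~~ (0 < j' <= n e')%N).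
Proof.
have outer f i : (i <= (n f).+1)%N -> ~~ (0 < i <= n f)%N ->
    exists v, node n f i = inl v.
  case: i => [|i] hi; first by exists (src f).
  rewrite /= -ltnNge => h; have -> : i = n f by lia.
  by exists (tgt f); rewrite insubF// ltnn.
have inner f i : (0 < i <= n f)%N ->
    exists k : 'I_(n f), i = k.+1 /\ node n f i = inr (existT (fun e' => 'I_(n e')) f k).
  by case: i => // i /= h; exists (Ordinal h); rewrite insubT.
move=> hj hj'.
case: (boolP (0 < j <= n e)%N) => h; case: (boolP (0 < j' <= n e')%N) => h'.
- have [k [jk ->]] := inner _ _ h; have [k' [jk' ->]] := inner _ _ h'.
  move=> hkk; left; split=> //.
    exact: (congr1 (fun x => if x is inr p then tag p else e) hkk).
  by rewrite jk jk' (congr1 (fun x => if x is inr p then nat_of_ord (tagged p) else 0%N) hkk).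
- have [k [jk ->]] := inner _ _ h; have [v ->] := outer _ _ hj' h'; by [].
- have [k [jk ->]] := inner _ _ h'; have [v ->] := outer _ _ hj h; by [].
- by right.
Qed.

Lemma sub_tail (d : dart H) : dart_tail d = node n (tag d.1) (tagged d.1 + d.2).
Proof. by case: d => p [] /=; rewrite ?addn1 ?addn0. Qed.

Lemma sub_head (d : dart H) : dart_head d = node n (tag d.1) (tagged d.1 + ~~ d.2).
Proof. by case: d => p [] /=; rewrite ?addn1 ?addn0. Qed.

Lemma subdivision_simple : (forall e, 1 < n e)%N -> simple_graph H.
Proof.
move=> n2; split=> [[[e k] b]|[[e k] b] [[e' k'] b']]; rewrite ?sub_tail ?sub_head /=.
  apply/negP => /eqP hd; have := ltn_ord k; rewrite ltnS => hk.
  have h1 : (k + b <= (n e).+1)%N by case: (b); lia.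
  have h2 : (k + ~~ b <= (n e).+1)%N by case: (b); lia.
  by have := n2 e; case: (node_eq h1 h2 hd) => -[]; case: (b); lia.
have := ltn_ord k; have := ltn_ord k'; rewrite !ltnS => hk' hk ht hh.
have b1 : (k + b <= (n e).+1)%N by case: (b); lia.
have b2 : (k + ~~ b <= (n e).+1)%N by case: (b); lia.
have b1' : (k' + b' <= (n e').+1)%N by case: (b'); lia.
have b2' : (k' + ~~ b' <= (n e').+1)%N by case: (b'); lia.
have h1 := node_eq b1 b1' ht; have h2 := node_eq b2 b2' hh.
have ee : e = e'.
  case: h1 => [[]//|[h1 _]]; case: h2 => [[]//|[h2 _]].
  by have := n2 e; case: (b) h1 h2; lia.
subst e'.
have [kk bb] : (k : nat) = k' /\ b = b'.
  have := n2 e; move: h1 h2; clear -hk hk'.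
  by case: (b); case: (b') => /= -[[? _ ?]|[? ?]] [[? _ ?]|[? ?]] ?; split=> //; lia.
by rewrite bb (val_inj kk).
Qed.

Lemma adj_sym (K : graph) : symmetric (@adj_vertices K).
Proof.
move=> u v; apply/existsP/existsP => -[d /andP[/eqP h1 /eqP h2]];
by exists (rev_dart d); rewrite dart_tail_rev dart_head_rev h1 h2 !eqxx.
Qed.

Lemma subdivision_connected : connected_graph G -> connected_graph H.
Proof.
move=> hG; have csym := sym_connect_sym (@adj_sym H).
have to_node e k : (k <= (n e).+1)%N -> connect (@adj_vertices H) (inl (src e)) (node n e k).
  elim: k => [_|k IH hk]; first exact: connect0.
  apply: connect_trans (IH (ltnW hk)) _; apply: connect1; apply/existsP.
  exists (existT (fun e => 'I_(n e).+1) e (Ordinal hk), false).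
  by rewrite sub_tail sub_head /= addn0 addn1 !eqxx.
have edge_conn u v : adj_vertices u v -> connect (@adj_vertices H) (inl u) (inl v).
  case/existsP => -[e b] /andP[/eqP <- /eqP <-].
  have := to_node e (n e).+1 (leqnn _); rewrite node_last.
  by case: b => //; rewrite csym.
have conn_inl u v : connect (@adj_vertices H) (inl u) (inl v).
  have /connectP[w hw ->] := hG u v.
  elim: w u hw => [|x w IH] u /=; first by move=> _; exact: connect0.
  by case/andP => /edge_conn hux /IH; exact: connect_trans.
have base (x : vertex H) : exists v, connect (@adj_vertices H) (inl v) x.
  case: x => [v|[e i]]; first by exists v; exact: connect0.
  exists (src e); have hi : (i.+1 <= (n e).+1)%N by rewrite ltnW// ltnS.
  have := to_node e i.+1 hi; rewrite node_inner// => hin.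
  by have -> : i = Ordinal (ltn_ord i) by apply: val_inj.
move=> x y; have [u hu] := base x; have [v hv] := base y.
apply: connect_trans hv; apply: connect_trans (conn_inl u v).
by rewrite csym.
Qed.

End SubdivisionGraph.

(** * The subdivision map is an isometry *)

Section Walks.
Context {R : realType} {G : graph}.
Variable len : edge G -> R.
Implicit Types (x y z : gpoint len) (w : seq (edge G * R * R)).

Lemma walk_cat x w y w' z : walk x w y -> walk y w' z -> walk x (w ++ w') z.
Proof.
elim: w x => [|[[e s] t] w IH] x /=; first by move=> ->.
by case=> h1 h2 h3 h4 h5; split=> //; exact: IH.
Qed.

Lemma walk_length_cat w w' : walk_length (w ++ w') = walk_length w + walk_length w'.
Proof. by rewrite /walk_length big_cat. Qed.

Lemma walk_length_cons e (s t : R) w :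
  walk_length ((e, s, t) :: w) = `|t - s| + walk_length w.
Proof. by rewrite /walk_length big_cons. Qed.

Lemma walk_length_nil : walk_length ([::] : seq (edge G * R * R)) = 0.
Proof. by rewrite /walk_length big_nil. Qed.

End Walks.

Section SubdivisionMap.
Context {R : realType} {G : graph}.
Variables (n : edge G -> nat) (len : edge G -> R) (pos : edge G -> nat -> R).
Hypothesis len0 : forall e, 0 < len e.
Hypothesis hpos : positions n len pos.
Local Notation H := (subdivision n).
Local Notation lenH := (@sub_len G R n pos).
Local Notation phi := (@subdivision_map G R n len pos).

(** The [k]-th edge of the path that replaces [e]. *)
Definition sub_edge e (k : 'I_(n e).+1) : edge H := existT (fun e => 'I_(n e).+1) e k.

Lemma sub_len_gt0 p : 0 < lenH p.
Proof.
case: p => e k; rewrite /sub_len subr_gt0 /=.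
by have [_ _ cS] := hpos e; apply: cS.
Qed.

Lemma pos_bound e k : (k <= (n e).+1)%N -> 0 <= pos e k <= len e.
Proof. exact: (cuts_bound (hpos e)). Qed.

Lemma subdivision_map_node e k : (k <= (n e).+1)%N ->
  phi (inl (node n e k)) = edge_point len e (pos e k).
Proof.
have [c0 cn cS] := hpos e.
case: k => [_|k]; first by rewrite c0 edge_point_src.
rewrite ltnS leq_eqVlt => /orP[/eqP->|kn].
  by rewrite node_last cn edge_point_tgt.
by rewrite node_inner.
Qed.

Lemma subdivision_map_edge_point (p : edge H) t : 0 <= t <= lenH p ->
  phi (edge_point lenH p t) = edge_point len (tag p) (pos (tag p) (tagged p) + t).
Proof.
case: p => e k /andP[]; rewrite le_eqVlt => /orP[/eqP<- _|t0].
  by rewrite edge_point_src// addr0 (@subdivision_map_node e k)// ltnW.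
rewrite le_eqVlt => /orP[/eqP->|tL].
  rewrite (edge_point_tgt sub_len_gt0)//.
  rewrite (@subdivision_map_node e k.+1)// /sub_len/=.
  by rewrite addrC subrK.
by rewrite edge_point_inner/= ?t0 ?tL.
Qed.

(** The dart of [G] parallel to a dart of its subdivision. *)
Definition lift_dart (d : dart H) : dart G := (tag d.1, d.2).

(** The distance from the tail of [lift_dart d] to the tail of [d], along
    [lift_dart d]. *)
Definition dart_offset (d : dart H) : R :=
  if d.2 then len (tag d.1) - pos (tag d.1) (tagged d.1).+1
  else pos (tag d.1) (tagged d.1).

Lemma dart_offset_bound d u : 0 <= u < lenH d.1 ->
  0 <= dart_offset d + u < len (lift_dart d).1.
Proof.
case: d => [[e k] b] /andP[u0 uL]; rewrite /dart_offset /=.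
have /andP[a1 a2] := @pos_bound e k (ltnW (ltn_ord k)).
have /andP[b1 b2] := @pos_bound e k.+1 (ltn_ord k).
by move: uL; rewrite /sub_len/= => uL; case: b => /=; lra.
Qed.

Lemma subdivision_map_dart_point d u : 0 <= u <= lenH d.1 ->
  phi (dart_point lenH d u) = dart_point len (lift_dart d) (dart_offset d + u).
Proof.
case: d => [p b] hu; rewrite /dart_point /= subdivision_map_edge_point; last first.
  by case: b hu => /=; lra.
congr edge_point; rewrite /dart_offset/=; case: b hu => //= _.
by rewrite /sub_len; ring.
Qed.

(** The darts of the subdivision that are parallel to [d] cover it, and by
    [lift_dart_unique] they do so without overlap. *)
Lemma lift_dart_exists (d : dart G) v : 0 <= v < len d.1 ->
  exists d' u, [/\ lift_dart d' = d, 0 <= u < lenH d'.1 & dart_offset d' + u = v].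
Proof.
case: d => e [] hv.
  have [|k kn /andP[k1 k2]] := @cuts_locate_left _ _ _ _ (len e - v) (hpos e); first by move: hv => /=; lra.
  exists (sub_edge (Ordinal kn), true), (pos e k.+1 - (len e - v)).
  split=> //; rewrite /sub_len /dart_offset /=; [lra|ring].
have [|k kn /andP[k1 k2]] := @cuts_locate_right _ _ _ _ v (hpos e); first by [].
exists (sub_edge (Ordinal kn), false), (v - pos e k).
split=> //; rewrite /sub_len /dart_offset /=; [lra|ring].
Qed.

Lemma lift_dart_unique d u d' u' : 0 <= u < lenH d.1 -> 0 <= u' < lenH d'.1 ->
  lift_dart d = lift_dart d' -> dart_offset d + u = dart_offset d' + u' ->
  d = d' /\ u = u'.
Proof.
case: d d' => [[e k] b] [[e' k'] b'] /= hu hu' [ee bb].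
subst e' b'; rewrite /dart_offset/= => huu.
suff kk : k = k' by subst k'; split=> //; case: b huu; lra.
have le_pos (i j : 'I_(n e).+1) : (i < j)%N -> pos e i.+1 <= pos e j.
  by move=> ij; apply: (cuts_le (hpos e)); rewrite ij ltnW.
apply: val_inj; move: hu hu'; rewrite /sub_len/=.
by case: (ltngtP k k') => // /le_pos; case: b huu => ? ? ? ?; exfalso; lra.
Qed.

Lemma subdivision_map_inj : injective phi.
Proof.
(* Apart from the vertices of [G], a point lies on a unique half-open edge
   of the subdivision, which contains its last node. *)
pose P e (k : 'I_(n e).+1) u := edge_point lenH (sub_edge k) u.
have cases x : (exists v, x = inl (inl v)) \/
    exists e (k : 'I_(n e).+1) u, [/\ x = P e k u,
      0 < u <= lenH (sub_edge k) & 0 < pos e k + u < len e].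
  case: x => [[v|[e i]]|[[[e k] u] /= hu]]; [by left; exists v|right|right].
    have hi : (i < (n e).+1)%N by rewrite ltnW// ltnS.
    exists e, (Ordinal hi), (lenH (sub_edge (Ordinal hi))).
    rewrite sub_len_gt0 lexx; split=> //.
      rewrite /P edge_point_tgt//; last exact: sub_len_gt0.
      rewrite [tgt _](_ : _ = node n e i.+1)// node_inner//.
      by congr (inl (inr (existT _ _ _))); apply: val_inj.
    rewrite /sub_len/= addrC subrK.
    have [c0 cn _] := hpos e.
    have hi' := ltn_ord i.
    have h1 : pos e 0 < pos e i.+1 by apply: (cuts_lt (hpos e)); lia.
    have h2 : pos e i.+1 < pos e (n e).+1 by apply: (cuts_lt (hpos e)); lia.
    by rewrite c0 in h1; rewrite cn in h2; rewrite h1 h2.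
  exists e, k, u; split.
  - by rewrite /P (@edge_point_inner _ _ _ (sub_edge k) u hu).
  - by move: hu => /=; lra.
  - have /andP[a1 a2] := @pos_bound e k (ltnW (ltn_ord k)).
    have /andP[b1 b2] := @pos_bound e k.+1 (ltn_ord k).
    by move: hu; rewrite /sub_len/=; lra.
move=> x y; case: (cases x) => [[v ->]|[e [k [u [-> hu hpu]]]]];
  case: (cases y) => [[v' ->]|[e' [k' [u' [-> hu' hpu']]]]].
- by move=> /= [->].
- rewrite subdivision_map_edge_point/=; last lra.
  by rewrite (@edge_point_inner _ _ _ e' _ hpu').
- rewrite subdivision_map_edge_point/=; last lra.
  by rewrite (@edge_point_inner _ _ _ e _ hpu).
rewrite !subdivision_map_edge_point/=; [|lra|lra].
case/edge_point_inj => // ee; subst e' => huu.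
have lt_pos (i j : 'I_(n e).+1) : (i < j)%N -> pos e i.+1 <= pos e j.
  by move=> ij; apply: (cuts_le (hpos e)); rewrite ij ltnW.
suff kk : k = k' by subst k'; congr (P e k _); lra.
apply: val_inj; move: hu hu'; rewrite /sub_len/=.
by case: (ltngtP k k') => // /lt_pos ? ? ?; exfalso; lra.
Qed.

Lemma subdivision_map_surj y : exists x, phi x = y.
Proof.
case: y => [v|[[e t] /= ht]]; first by exists (inl (inl v)).
have [|d' [u [hd hu huv]]] := @lift_dart_exists (e, false) t; first by rewrite /=; lra.
exists (dart_point lenH d' u); rewrite subdivision_map_dart_point; last lra.
by rewrite hd huv /dart_point/= (@edge_point_inner _ _ _ e t ht).
Qed.

Lemma subdivision_map_bij : bijective phi.
Proof. exact: inj_surj_bijective subdivision_map_inj subdivision_map_surj. Qed.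

(** A segment of an edge of [G] is travelled in the subdivision by a walk of
    the same length. *)
Lemma subdivision_segment e s t : 0 <= s <= len e -> 0 <= t <= len e ->
  forall x y, phi x = edge_point len e s -> phi y = edge_point len e t ->
  exists2 w, walk x w y & walk_length w = `|t - s|.
Proof.
have [c0 cn cS] := hpos e.
have main k : (k <= (n e).+1)%N -> forall s t, 0 <= s -> s <= t -> t <= pos e k ->
    forall x y, phi x = edge_point len e s -> phi y = edge_point len e t ->
    (exists2 w, walk x w y & walk_length w = t - s) /\
    (exists2 w, walk y w x & walk_length w = t - s).
  elim: k => [|k IH] hk {}s {}t s0 st tk x y hx hy.
    have [s00 t00] : s = 0 /\ t = 0 by rewrite c0 in tk; split; lra.
    have -> : x = y by apply: subdivision_map_inj; rewrite hx hy s00 t00.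
    by rewrite s00 t00 subrr; split; exists [::] => //; rewrite walk_length_nil.
  have [tk'|tk'] := leP t (pos e k); first exact: (IH (ltnW hk)).
  pose p := sub_edge (Ordinal hk).
  have step s' x' : pos e k <= s' <= t -> phi x' = edge_point len e s' ->
      walk x' [:: (p, s' - pos e k, t - pos e k)] y /\
      walk y [:: (p, t - pos e k, s' - pos e k)] x'.
    move=> hs' hx'.
    have hp : lenH p = pos e k.+1 - pos e k by [].
    have xE : x' = edge_point lenH p (s' - pos e k).
      apply: subdivision_map_inj; rewrite hx' subdivision_map_edge_point/= ?hp; last lra.
      by rewrite addrC subrK.
    have yE : y = edge_point lenH p (t - pos e k).
      apply: subdivision_map_inj; rewrite hy subdivision_map_edge_point/= ?hp; last lra.
      by rewrite addrC subrK.
    by split=> /=; rewrite hp; split=> //; lra.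
  have [ks|ks] := leP (pos e k) s.
    have [|w1 w2] := step s x _ hx; first by rewrite ks st.
    by split; [exists [:: (p, s - pos e k, t - pos e k)]
              |exists [:: (p, t - pos e k, s - pos e k)]] => //;
      rewrite walk_length_cons walk_length_nil addr0 opprB addrA subrK ?[`|s - t|]distrC ger0_norm// subr_ge0.
  have [z hz] := subdivision_map_surj (edge_point len e (pos e k)).
  have [[w1 hw1 l1] [w2 hw2 l2]] := IH (ltnW hk) s (pos e k) s0 (ltW ks) (lexx _) x z hx hz.
  have [|v1 v2] := step (pos e k) z _ hz; first by rewrite lexx ltW.
  split.
    exists (w1 ++ [:: (p, pos e k - pos e k, t - pos e k)]); first exact: walk_cat v1.
    rewrite walk_length_cat l1 walk_length_cons walk_length_nil subrr subr0 addr0.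
    by rewrite ger0_norm; lra.
  exists ([:: (p, t - pos e k, pos e k - pos e k)] ++ w2); first exact: walk_cat hw2.
  rewrite walk_length_cat l2 walk_length_cons walk_length_nil subrr sub0r normrN addr0.
  by rewrite ger0_norm; lra.
move=> hs ht x y hx hy; have [st|ts] := leP s t.
  have [|||[w hw lw] _] := main (n e).+1 (leqnn _) s t _ _ _ x y hx hy; [lra|lra|by rewrite cn; lra|].
  by exists w => //; rewrite lw ger0_norm// subr_ge0.
have [|||_ [w hw lw]] := main (n e).+1 (leqnn _) t s _ _ _ y x hy hx; [lra|lra|by rewrite cn; lra|].
by exists w => //; rewrite lw distrC ger0_norm// subr_ge0 ltW.
Qed.

Lemma subdivision_isometry : mg_isometry phi.
Proof.
split=> [|x y]; first exact: subdivision_map_bij.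
rewrite /gdist; congr inf; apply/seteqP; split=> l [w hw <-].
  elim: w x hw => [|[[e s] t] w IH] x /=.
    move=> /subdivision_map_inj ->; exists [::] => //=.
    by rewrite !walk_length_nil.
  case=> hs ht hx hw; have [z hz] := subdivision_map_surj (edge_point len e t).
  rewrite -hz in hw; have [w' hw' lw'] := IH z hw.
  have [w1 hw1 l1] := subdivision_segment hs ht hx hz.
  exists (w1 ++ w'); first exact: walk_cat hw'.
  by rewrite walk_length_cat l1 lw' walk_length_cons.
elim: w x hw => [|[[p s] t] w IH] x /=.
  by move=> ->; exists [::] => //; rewrite !walk_length_nil.
case=> hs ht -> /IH[w' hw' lw'].
exists ((tag p, pos (tag p) (tagged p) + s, pos (tag p) (tagged p) + t) :: w').
  have /andP[a1 a2] := @pos_bound (tag p) (tagged p) (ltnW (ltn_ord _)).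
  have /andP[b1 b2] := @pos_bound (tag p) (tagged p).+1 (ltn_ord _).
  have hp : lenH p = pos (tag p) (tagged p).+1 - pos (tag p) (tagged p) by [].
  rewrite hp in hs ht.
  split; [lra|lra| |].
    by rewrite subdivision_map_edge_point// hp.
  by rewrite -subdivision_map_edge_point// hp.
by rewrite !walk_length_cons lw' opprD addrACA subrr add0r.
Qed.

Lemma subdivision_metric_graph : metric_graph len -> metric_graph lenH.
Proof.
move=> [hc hE _]; split; [exact: subdivision_connected| |exact: sub_len_gt0].
move: hE => /card_gt0P[e _]; apply/card_gt0P.
by exists (sub_edge (ord0 : 'I_(n e).+1)).
Qed.

End SubdivisionMap.

(** * The slope structure induced on a subdivision *)

Section InducedStructure.
Context {r : nat} {R : realType} {G : graph}.
Variables (n : edge G -> nat) (len : edge G -> R) (pos : edge G -> nat -> R).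
Hypothesis hlen : metric_graph len.
Hypothesis hpos : positions n len pos.
Hypothesis n2 : forall e, (1 < n e)%N.
Variable S : slope_data r len.
Hypothesis hS : slope_structure S.
Variable sg : edge G -> nat -> 'I_r.+1 -> int.
Hypothesis hrun : forall e k, (k < (n e).+1)%N ->
  slope_run S (e, false) (pos e k) (pos e k.+1) (sg e k).
Local Notation H := (subdivision n).
Local Notation lenH := (@sub_len G R n pos).
Local Notation phi := (@subdivision_map G R n len pos).

Let len0 e : 0 < len e. Proof. by case: hlen. Qed.

(** The slopes that [S] induces on the darts of the subdivision. *)
Definition sub_slope (d : dart H) (i : 'I_r.+1) : int :=
  if d.2 then - sg (tag d.1) (tagged d.1) (rev_ord i) else sg (tag d.1) (tagged d.1) i.

Lemma sub_slope_run d :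
  slope_run S (lift_dart d) (dart_offset len pos d) (dart_offset len pos d + lenH d.1) (sub_slope d).
Proof.
case: d => [[e k] b]; have h := hrun (ltn_ord k).
rewrite /dart_offset /sub_slope /sub_len /lift_dart /=; case: b => /=; last by rewrite subrKC.
by have := slope_run_rev h; rewrite /= [_ - _ + _]addrA subrK.
Qed.

Lemma sub_slope_incr d (i j : 'I_r.+1) : (i < j)%N -> sub_slope d i < sub_slope d j.
Proof.
case: d => [[e k] b] ij; rewrite /sub_slope /=.
have /andP[a1 a2] := @pos_bound _ _ _ _ _ hpos e k (ltnW (ltn_ord k)).
have /andP[b1 b2] := @pos_bound _ _ _ _ _ hpos e k.+1 (ltn_ord k).
have [_ _ cS] := hpos e; have ck := cS k (ltn_ord k).
have h : 0 <= pos e k < pos e k.+1 by rewrite a1.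
case: b; rewrite ?ltrN2; apply: (slope_run_incr len0 hS (hrun (ltn_ord k)) h b2) => //=.
by have := ltn_ord j; lia.
Qed.

Lemma sub_slope_rev d i : sub_slope d i + sub_slope (rev_dart d) (rev_ord i) = 0.
Proof. by case: d => [p []]; rewrite /sub_slope /= ?rev_ordK ?subrr ?addNr. Qed.

Lemma starts_at_lift x d : starts_at x d -> starts_at (phi x) (lift_dart d).
Proof.
move=> hd; have hb := dart_pos_bound (sub_len_gt0 hpos) hd.
rewrite -(dart_point_pos (sub_len_gt0 hpos) hd) (subdivision_map_dart_point len0 hpos); last lra.
by apply: starts_at_dart_point => //; exact: dart_offset_bound.
Qed.

Lemma dart_pos_lift x d : starts_at x d ->
  dart_pos (phi x) (lift_dart d) = dart_offset len pos d + dart_pos x d.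
Proof.
move=> hd; have hb := dart_pos_bound (sub_len_gt0 hpos) hd.
rewrite -{1}(dart_point_pos (sub_len_gt0 hpos) hd) (subdivision_map_dart_point len0 hpos); last lra.
by rewrite dart_posE//; exact: dart_offset_bound.
Qed.

(** The differential of the subdivision map. *)
Definition dsub x (nu : tangent x) : tangent (phi x) :=
  Sub (lift_dart (val nu)) (starts_at_lift (valP nu)).

Lemma dsub_bij x : bijective (@dsub x).
Proof.
apply: inj_surj_bijective => [nu mu /(congr1 val)/= hl|nu].
  apply: val_inj; have h1 := valP nu; have h2 := valP mu.
  have b1 := dart_pos_bound (sub_len_gt0 hpos) h1.
  have b2 := dart_pos_bound (sub_len_gt0 hpos) h2.
  by have [] := lift_dart_unique hpos b1 b2 hl; rewrite // -!dart_pos_lift// hl.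
have hb := dart_pos_bound len0 (valP nu).
have [d [u [hd hu huv]]] := lift_dart_exists hpos hb.
have hx : dart_point lenH d u = x.
  apply: (subdivision_map_inj len0 hpos).
  rewrite (subdivision_map_dart_point len0 hpos); last lra.
  by rewrite hd huv dart_point_pos//; exact: valP.
have hs : starts_at x d by rewrite -hx; apply: starts_at_dart_point => //; exact: sub_len_gt0.
by exists (Sub d hs); apply: val_inj.
Qed.

(** An inverse of the differential, needed as a function to transport the rank
    functions of [S]. *)
Definition dsub_inv x : {g : tangent (phi x) -> tangent x |
  cancel (@dsub x) g /\ cancel g (@dsub x)}.
Proof. by apply: cid; have [g h1 h2] := dsub_bij x; exists g. Qed.

(** The rank function of [S] at the image of the vertex [v] of the
    subdivision. *)
Definition sub_rank (v : vertex H) (a : cube r {d : dart H | dart_tail d == v}) : int :=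
  rk S [ffun nu => (a : cube r (tangent (inl v : gpoint lenH))) (sval (dsub_inv (inl v)) nu)].

Lemma sub_rank_function v : rank_function (@sub_rank v).
Proof.
have [h1 h2] := svalP (dsub_inv (inl v)).
apply: (@rank_function_reindex r _ _ (sval (dsub_inv (inl v))) _ (@rk _ _ _ _ S _) (@sub_rank v)).
- by exists (@dsub (inl v)).
- by [].
- exact: rk_rank.
Qed.

(** The slope structure on the subdivision that is read off from [S]. *)
Definition sub_structure : graph_slope_structure r H :=
  @GraphSlopeStructure r H (subdivision_simple n2) sub_slope sub_slope_incr
    sub_slope_rev sub_rank sub_rank_function.

Lemma sub_structure_induced : induced_from phi sub_structure S.
Proof.
split; first exact: subdivision_metric_graph.
  exact: subdivision_isometry.
move=> x; exists (@dsub x); split; first exact: dsub_bij.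
- move=> nu; apply/near0_rightP.
  have hb := dart_pos_bound (sub_len_gt0 hpos) (valP nu).
  exists (lenH (val nu).1 - dart_pos x (val nu)); first lra.
  move=> t ht; rewrite !move_alongE (subdivision_map_dart_point len0 hpos); last lra.
  by rewrite dart_pos_lift ?addrA//; exact: valP.
- move=> nu i; rewrite -dslE.
  have hb := dart_pos_bound (sub_len_gt0 hpos) (valP nu).
  rewrite -{1}(dart_point_pos (sub_len_gt0 hpos) (valP nu)).
  rewrite (subdivision_map_dart_point len0 hpos); last lra.
  have [h1 _ _] := sub_slope_run (val nu).
  by rewrite h1//; lra.
case: x => [v|[[p t] /= ht]] a /=.
  rewrite /sub_rank; congr (rk S _); apply/ffunP => nu; rewrite !ffunE.
  by have [_ h2] := svalP (dsub_inv (inl v)); rewrite h2.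
rewrite (standard_rank_reindex (dsub_bij _)).
have [_ _ h3] := sub_slope_run (p, false).
by apply: (h3 (pos (tag p) (tagged p) + t)); rewrite /dart_offset /=; lra.
Qed.

End InducedStructure.

(** * Finitely many slope structures *)

Section FinitelyMany.
Variables (r : nat) (H : graph) (B : nat).

(** Pointwise equality of the slopes and rank functions, the proofs of the
    axioms being left aside. *)
Definition gss_equiv (s s' : graph_slope_structure r H) : Prop :=
  (forall d i, gslope s d i = gslope s' d i) /\
  (forall v a, @grank r H s v a = @grank r H s' v a).

(** All slopes have absolute value at most [B]. *)
Definition gss_bounded (s : graph_slope_structure r H) : Prop :=
  forall d i, `|gslope s d i| <= B%:Z.

(** Bounded slopes and rank functions, as functions between finite types: the
    slopes are shifted by [B] and the ranks, which are at least [-1], by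
    [1]. *)
Definition gss_code (s : graph_slope_structure r H) :
    {ffun dart H * 'I_r.+1 -> 'I_(2 * B).+1} *
    {ffun {v : vertex H & cube r {d : dart H | dart_tail d == v}} -> 'I_r.+2} :=
  ([ffun p => inord `|gslope s p.1 p.2 + B%:Z|],
   [ffun q => inord `|@grank r H s (tag q) (tagged q) + 1|]).

Lemma gss_code_inj s s' : gss_bounded s -> gss_bounded s' ->
  gss_code s = gss_code s' -> gss_equiv s s'.
Proof.
move=> bs bs' [/ffunP h1 /ffunP h2]; split=> [d i|v a].
  have := congr1 val (h1 (d, i)); rewrite !ffunE /=.
  have := bs d i; have := bs' d i => b b'.
  by rewrite !inordK; lia.
have := congr1 val (h2 (existT _ v a)); rewrite !ffunE /=.
have [_ _ _ b] := grank_rank s v; have [_ _ _ b'] := grank_rank s' v.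
by have := b a; have := b' a => {}b {}b'; rewrite !inordK; lia.
Qed.

Lemma finitely_many_gss : exists (k : nat) (s : 'I_k -> graph_slope_structure r H),
  forall s0, gss_bounded s0 -> exists j, gss_equiv (s j) s0.
Proof.
pose P c := `[< exists s, gss_bounded s /\ gss_code s = c >].
have hP (c : {c | P c}) : exists s, gss_bounded s /\ gss_code s = val c.
  exact/asboolP/(valP c).
exists #|{: {c | P c}}|, (fun j => sval (cid (hP (enum_val j)))).
move=> s0 bs0; have Pc : P (gss_code s0) by apply/asboolP; exists s0.
exists (enum_rank (Sub (gss_code s0) Pc : {c | P c})).
case: cid => s /= [bs]; rewrite enum_rankK /= => hc.
exact: gss_code_inj.
Qed.

End FinitelyMany.

Lemma induced_from_equiv r (R : realType) (H G : graph) (lenH : edge H -> R)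
    (len : edge G -> R) (phi : gpoint lenH -> gpoint len)
    (s s' : graph_slope_structure r H) (S : slope_data r len) :
  gss_equiv s s' -> induced_from phi s' S -> induced_from phi s S.
Proof.
move=> [h1 h2] [hm hi ht].
have hrk x (a : cube r (tangent x)) : rk (realize s' lenH) a = rk (realize s lenH) a.
  by case: x a => [v|p] a //=; rewrite h2.
split=> // x; have [dphi [b n l k]] := ht x.
exists dphi; split=> //.
- by move=> nu i; rewrite l /= h1.
- by move=> a; rewrite k hrk.
Qed.

Theorem theorem1p4 (R : realType) (G : graph) (len : edge G -> R)
  (hlen : metric_graph len) (D : divisor len)
  (hD : supported_on_vertices D) (r : nat) :
  exists (k : nat) (n : 'I_k -> edge G -> nat)
         (s : forall j : 'I_k, graph_slope_structure r (subdivision (n j))),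
    forall (M : set (gpoint len -> R)) (S : slope_data r len),
      admissible D M S ->
      exists (j : 'I_k) (pos : edge G -> nat -> R),
        positions (n j) len pos /\
        induced_from (@subdivision_map G R (n j) len pos) (s j) S.
Proof.
have len0 e : 0 < len e by case: hlen.
pose n (e : edge G) := (@piece_bound r R G len D).-1.
have [k [s hs]] := finitely_many_gss r (subdivision n) `|slope_bound D|.
exists k, (fun=> n), s => M S hM.
have hS : slope_structure S by case: hM.
have [pos hpos] := choice (admissible_cuts len0 hD hM).
have hpos' : positions n len pos by move=> e; have [] := hpos e.
have : forall e, exists sg : nat -> 'I_r.+1 -> int, forall k, (k < (n e).+1)%N ->
    slope_run S (e, false) (pos e k) (pos e k.+1) (sg k).
  move=> e.
  have : forall i, exists sg : 'I_r.+1 -> int, (i < (n e).+1)%N ->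
      slope_run S (e, false) (pos e i) (pos e i.+1) sg.
    move=> i; case: (boolP (i < (n e).+1)%N) => [hi|_]; last by exists (fun=> 0).
    by have [_ /(_ i hi)[sg hsg]] := hpos e; exists sg.
  by case/choice => sg hsg; exists sg.
case/choice => sg hrun.
have n2 e : (1 < n e)%N by [].
have [|j hj] := hs (sub_structure hlen hpos' n2 hS hrun).
  move=> [[e i] b] t; rewrite gez0_abs ?slope_bound_ge0//.
  have /andP[a1 a2] := @pos_bound _ _ _ _ _ hpos' e i (ltnW (ltn_ord i)).
  have /andP[b1 b2] := @pos_bound _ _ _ _ _ hpos' e i.+1 (ltn_ord i).
  have [_ _ cS] := hpos' e; have ci := cS i (ltn_ord i).
  have h : 0 <= pos e i < pos e i.+1 by rewrite a1.
  rewrite /= /sub_slope /=.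
  by case: b; rewrite ?normrN; apply: (run_bound len0 hD hM _ (hrun e i (ltn_ord i))).
exists j, pos; split=> //.
apply: induced_from_equiv hj _; exact: sub_structure_induced.
Qed.
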